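(* Let $G$ be a connected graph with incidence matrix $\partial_1$, let $\partial$ be an integer matrix (rows indexed by $E(G)$) with $\partial_1\partial=0$ and $\operatorname{rk}\partial=n$ (the rank of $\ker\partial_1/\operatorname{im}\partial$ is arbitrary), and let $\lambda$ be a harmonic cycle, i.e. $\lambda\in\ker\partial_1\cap\ker\partial^t$. Then $\lambda\circ v=0$ for every column $v$ of $\partial$. Put $m=\operatorname{rk}\ker\partial_1$ and let $V$ be the vector space $$V=\{v : \lambda\circ v=0 \text{ and } v\in\ker\partial_1\}.$$ Then $\operatorname{rk}V=m-1$, there is a basis of $V$ including $n$ columns of $\partial$, and, writing such a basis as the columns of a matrix $\partial'$, the harmonic cycle $\lambda$ is a multiple of the standard harmonic cycle made from $(G,\partial')$; that is, $$\lambda=d\cdot\sum_{Y\in\mathcal{U}(G)}w(z_Y)\cdot z_Y$$ for some $d$, where $w(z)=\det([z]_\beta,[\partial']_\beta)$ is the winding number map of $(G,\partial')$ relative to a fixed basis $\beta$ of $Z_1(G)$. (So every harmonic cycle is basically a harmonic cycle from the case where the first homology has rank 1.) Moreover, if all entries of $\lambda$ are rational, then $\partial'$ can be found with integer entries, and an actual CW-complex can be constructed from the information $\partial'$.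
   Context: Graphs are finite and connected; loops and multiple edges are allowed. Fix an orientation of each edge. $\partial_1:\mathbb{Z}^{E(G)}\to\mathbb{Z}^{V(G)}$ is the (oriented) incidence matrix (a loop gives a zero column), also used with real coefficients. $Z_1(G)=\ker\partial_1$ (over $\mathbb{Z}$) is a free abelian group of rank $m$. The symbol $\circ$ is the standard inner product on $\mathbb{R}^{E(G)}$ for which the edges are orthonormal. A harmonic cycle of the chain complex given by $\partial$ and $\partial_1$ is an element of $\ker(\partial_1^t\partial_1+\partial\,\partial^t)=\ker\partial_1\cap\ker\partial^t$ in $\mathbb{R}^{E(G)}$. For a $\mathbb{Z}$-basis $\beta$ of $Z_1(G)$, $[z]_\beta$ is the coordinate column vector of $z\in\ker\partial_1$ (real coefficients allowed), $[\partial']_\beta$ is the matrix whose columns are the coordinate vectors of the columns of $\partial'$, and $([z]_\beta,[\partial']_\beta)$ is the matrix with first column $[z]_\beta$ followed by the columns of $[\partial']_\beta$. A cycletree of $G$ is a connected spanning subgraph $Y$ of $G$ containing exactly one cycle $C_Y$ (a loop, or a pair of parallel edges, may be that cycle). $\mathcal{U}(G)$ is the set of cycletrees of $G$. $z_Y\in Z_1(G)$ is the $\{0,\pm1\}$-vector of $C_Y$ with either orientation chosen; the product $w(z_Y)\cdot z_Y$ does not depend on this choice. The standard harmonic cycle made from $(G,\partial')$ is the sum $\sum_{Y\in\mathcal{U}(G)}w(z_Y)\cdot z_Y$.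
   Formalization: Every claim after the orthogonality of λ to the columns of ∂ is stated for a nonzero harmonic cycle λ, because for λ = 0 the space V is all of ker ∂₁ and rk V = m − 1 fails. *)

(* Defs.v *)
From HB Require Import structures.
From mathcomp Require Import all_boot all_order all_algebra.
From mathcomp Require Import all_classical all_reals all_analysis.
Set Implicit Arguments.
Unset Strict Implicit.
Unset Printing Implicit Defensive.
Import Order.TTheory GRing.Theory Num.Theory numFieldNormedType.Exports.
Local Open Scope classical_set_scope.
Local Open Scope ring_scope.

(* A finite oriented multigraph on vertices 'I_p and edges 'I_q: edge e runs
   from [tail e] to [head e].  Loops and parallel edges are allowed. *)
Record multigraph (p q : nat) := Multigraph {
  tail : 'I_q -> 'I_p;
  head : 'I_q -> 'I_p
}.

Section Graph.
Context {p q : nat}.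
Variable G : multigraph p q.

Definition adjacent_in (Y : {set 'I_q}) : rel 'I_p := fun u v =>
  [exists e in Y, ((tail G e == u) && (head G e == v)) ||
                  ((tail G e == v) && (head G e == u))].

(* Connectedness of the spanning subgraph with edge set Y. *)
Definition connected_spanning (Y : {set 'I_q}) : Prop :=
  (0 < p)%N /\ forall u v : 'I_p, fingraph.connect (adjacent_in Y) u v.

Definition connected_graph : Prop := connected_spanning [set: 'I_q]%SET.

(* A loop contributes 1 - 1 = 0, hence gives a zero column. *)
Definition incidence : 'M[int]_(p, q) :=
  \matrix_(v, e) ((v == head G e)%:R - (v == tail G e)%:R).

(* A dart is an edge with a direction of traversal; [true] is the direction
   of the orientation of the edge. *)
Definition dart : Type := ('I_q * bool)%type.
Definition dtail (d : dart) : 'I_p := if d.2 then tail G d.1 else head G d.1.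
Definition dhead (d : dart) : 'I_p := if d.2 then head G d.1 else tail G d.1.

(* Nonempty closed walks without repeated vertices or edges.  Asking for
   distinct edges only rules out traversing one edge back and forth; loops
   (length 1) and pairs of parallel edges (length 2) are included. *)
Definition simple_cycle (s : seq dart) : bool :=
  [&& s != [::], path.cycle (fun d d' => dhead d == dtail d') s,
      uniq (map dtail s) & uniq (map fst s)].

Definition is_cycle (C : {set 'I_q}) : Prop :=
  exists2 s : seq dart, simple_cycle s & C = [set e in map fst s]%SET.

Definition cycletree (Y : {set 'I_q}) : Prop :=
  connected_spanning Y /\
  exists! C : {set 'I_q}, is_cycle C /\ (C \subset Y).

Definition walk_vector (s : seq dart) : 'cV[int]_q :=
  \sum_(d <- s) (if d.2 then 1 else -1) *: delta_mx d.1 0.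

(* z is one of the two possible vectors z_Y (one for each orientation of the
   cycle contained in Y). *)
Definition is_cycle_vector (Y : {set 'I_q}) (z : 'cV[int]_q) : Prop :=
  exists2 s : seq dart, simple_cycle s &
    [set e in map fst s]%SET \subset Y /\ z = walk_vector s.

(* The columns of beta form a Z-basis of Z_1(G). *)
Definition Z1_basis (m : nat) (beta : 'M[int]_(q, m)) : Prop :=
  incidence *m beta = 0 /\
  forall z : 'cV[int]_q, incidence *m z = 0 ->
    exists! c : 'cV[int]_m, z = beta *m c.

End Graph.

Section Harmonic.
Context {R : realType}.

Definition toR {a b : nat} (A : 'M[int]_(a, b)) : 'M[R]_(a, b) :=
  map_mx intr A.

Definition inner {q : nat} (u v : 'cV[R]_q) : R := (u^T *m v) 0 0.

Definition columns {q k : nat} (A : 'M[R]_(q, k)) : k.-tuple 'cV[R]_q :=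
  [tuple col j A | j < k].

Definition ker_incidence {p q} (G : multigraph p q) : {vspace 'cV[R]_q} :=
  lker (linfun (mulmx (toR (incidence G)) : 'cV[R]_q -> 'cV[R]_p)).

(* Its kernel consists of the harmonic cycles. *)
Definition laplacian {p q l} (G : multigraph p q) (bd : 'M[int]_(q, l))
    : 'M[R]_q :=
  (toR (incidence G))^T *m toR (incidence G) + toR bd *m (toR bd)^T.

Definition harmonic_cycle {p q l} (G : multigraph p q) (bd : 'M[int]_(q, l))
    (lambda : 'cV[R]_q) : Prop :=
  laplacian G bd *m lambda = 0.

(* V = {v | lambda o v = 0 and v in ker partial_1} *)
Definition orthV {p q} (G : multigraph p q) (lambda : 'cV[R]_q)
    : {vspace 'cV[R]_q} :=
  (lker (linfun (mulmx lambda^T : 'cV[R]_q -> 'M[R]_1)) :&: ker_incidence G)%VS.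

Definition includes_columns {q l k} (n : nat) (bd : 'M[R]_(q, l))
    (bd' : 'M[R]_(q, k)) : Prop :=
  exists (f : 'I_n -> 'I_l) (g : 'I_n -> 'I_k),
    [/\ injective f, injective g & forall i, col (g i) bd' = col (f i) bd].

(* Column j of [coords beta A] is the coordinate vector of column j of A. *)
Definition coords {q m k} (beta : 'M[int]_(q, m)) (A : 'M[R]_(q, k))
    : 'M[R]_(m, k) :=
  \matrix_(i, j) coord (columns (toR beta)) i (col j A).

Definition winding {q r} (beta : 'M[int]_(q, r.+1)) (bd' : 'M[R]_(q, r))
    (z : 'cV[R]_q) : R :=
  \det (row_mx (coords beta z) (coords beta bd') : 'M[R]_(1 + r)).

(* [zY Y] is the chosen vector of the cycle of the cycletree Y. *)
Definition standard_harmonic_cycle {p q r} (G : multigraph p q)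
    (beta : 'M[int]_(q, r.+1)) (bd' : 'M[R]_(q, r))
    (zY : {set 'I_q} -> 'cV[int]_q) : 'cV[R]_q :=
  \sum_(Y : {set 'I_q} | `[< cycletree G Y >])
    winding beta bd' (toR (zY Y)) *: toR (zY Y).

End Harmonic.

Section CWComplex.
Context {R : realType}.

Definition closed_disk : set (R * R) := [set x | x.1 ^+ 2 + x.2 ^+ 2 <= 1].
Definition open_disk : set (R * R) := [set x | x.1 ^+ 2 + x.2 ^+ 2 < 1].
Definition unit_circle : set (R * R) := [set x | x.1 ^+ 2 + x.2 ^+ 2 = 1].

Definition circle_param (s : R) : R * R :=
  (cos (pi *+ 2 * s), sin (pi *+ 2 * s)).

(* Given characteristic maps of p vertices, q edges and k 2-cells, the open
   cell with a given label. *)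
Definition open_cell {p q k} {X : Type} (c0 : 'I_p -> X) (c1 : 'I_q -> R -> X)
    (c2 : 'I_k -> R * R -> X) (c : 'I_p + 'I_q + 'I_k) : set X :=
  match c with
  | inl (inl v) => [set c0 v]
  | inl (inr e) => c1 e @` `]0, 1[
  | inr f => c2 f @` open_disk
  end.

(* A finite CW-complex of dimension at most 2 whose 1-skeleton is the oriented
   graph G and which has k 2-cells.  For finitely many cells the weak topology
   axiom is automatic, as each characteristic map has compact domain and
   X is Hausdorff. *)
Record cw_complex {p q : nat} (G : multigraph p q) (k : nat) := CWComplex {
  cw_space :> topologicalType;
  cell0 : 'I_p -> cw_space;
  cell1 : 'I_q -> R -> cw_space;
  cell2 : 'I_k -> R * R -> cw_space;
  cw_hausdorff : hausdorff_space cw_space;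
  cell1_continuous : forall e, {within `[0, 1], continuous (cell1 e)};
  cell2_continuous : forall f, {within closed_disk, continuous (cell2 f)};
  cell1_inj : forall e, {in `]0, 1[ &, injective (cell1 e)};
  cell2_inj : forall f, set_inj open_disk (cell2 f);
  cells_partition : forall x, exists! c, open_cell cell0 cell1 cell2 c x;
  cell1_tail : forall e, cell1 e 0 = cell0 (tail G e);
  cell1_head : forall e, cell1 e 1 = cell0 (head G e);
  cell2_attached : forall f x, unit_circle x ->
    exists c : 'I_p + 'I_q, open_cell cell0 cell1 cell2 (inl c) (cell2 f x)
}.

(* Identify R/Z with the quotient of the 1-skeleton collapsing the complement
   of the open edge e, by means of the characteristic map of e: the real number
   y represents the image of the point x. *)
Definition collapse {p q k} {G : multigraph p q} (X : cw_complex G k)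
    (e : 'I_q) (x : X) (y : R) : Prop :=
  (exists2 t : R, t \in `]0, 1[ & cell1 X e t = x /\ y - t \is a Num.int) \/
  (~ (cell1 X e @` `]0, 1[) x /\ y \is a Num.int).

(* The incidence number [f : e] equals n: the degree of the circle map
     S^1 -> X^1 -> X^1 / (X^1 - e) = R/Z
   is g(1) - g(0) for any continuous lift g : [0, 1] -> R of it. *)
Definition incidence_number {p q k} {G : multigraph p q} (X : cw_complex G k)
    (e : 'I_q) (f : 'I_k) (n : int) : Prop :=
  exists g : R -> R, [/\ {within `[0, 1], continuous g},
    forall s, s \in `[0, 1] -> collapse e (cell2 X f (circle_param s)) (g s) &
    g 1 - g 0 = n%:~R].

(* D is the second cellular boundary map of X. *)
Definition cellular_boundary {p q k} {G : multigraph p q} (X : cw_complex G k)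
    (D : 'M[int]_(q, k)) : Prop :=
  forall e f, incidence_number X e f (D e f).

End CWComplex.
Arguments cw_complex R {p q} G k.

(* Main.v *)
(* A linear form on ker d_1 that vanishes on V is a multiple of lambda o -, so
   w(z_Y) = c (lambda o z_Y) with c nonzero, and everything reduces to the
   identity
     sum_Y (x o z_Y) z_Y = t x     for x in ker d_1, t = number of spanning trees.
   The map (Y, e) |-> (Y \ e, e) is a bijection from the pairs with e in C_Y to
   the pairs (T, e) of a spanning tree and an edge outside it, and for each T the
   sum of x_e z_{T+e}(e) z_{T+e} over e outside T is x: the difference is a cycle
   supported on T, hence 0.

   An integral D with d_1 D = 0 is realized by attaching each 2-cell along a
   closed walk with the prescribed class.  The space is a subset of R^8: four
   coordinates embed the graph, and on the 2-cell f the other four are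
   (1 - x^2 - y^2) (1, x, y, f), which separate the open disks, so that any
   continuous extension of the attaching map to the disk can be used for the
   first four. *)
Require Import Defs.
From mathcomp Require Import all_boot all_order all_algebra.
From mathcomp Require Import all_classical all_reals all_analysis.
From mathcomp Require Import ring lra.
Set Implicit Arguments.
Unset Strict Implicit.
Unset Printing Implicit Defensive.
Import Order.TTheory GRing.Theory Num.Theory numFieldNormedType.Exports.
Local Open Scope ring_scope.

(** * Kernels of matrices and harmonic cycles *)

Section MatrixKernels.
Variable F : fieldType.

(** Shaped like [ker_incidence], so that [ker_incidenceE] holds by conversion, but over any field,
    since [rat] is needed as well as [R]. *)
Definition mx_ker k q (N : 'M[F]_(k, q)) : {vspace 'cV[F]_q} :=
  lker (linfun (mulmx N : 'cV_q -> 'cV_k)).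

Definition mx_columns q k (A : 'M[F]_(q, k)) : k.-tuple 'cV[F]_q :=
  [tuple col j A | j < k].

Lemma mem_mx_ker k q (N : 'M[F]_(k, q)) v : (v \in mx_ker N) = (N *m v == 0).
Proof. by rewrite memv_ker lfunE. Qed.

Lemma nth_mx_columns q k (A : 'M[F]_(q, k)) (j : 'I_k) :
  (mx_columns A)`_j = col j A.
Proof. by rewrite -tnth_nth tnth_mktuple. Qed.

Lemma sum_mx_columns q k (A : 'M[F]_(q, k)) (c : 'I_k -> F) :
  \sum_(j < k) c j *: (mx_columns A)`_j = A *m \col_j c j.
Proof.
apply/colP => i; rewrite summxE mxE; apply: eq_bigr => j _.
by rewrite nth_mx_columns !mxE mulrC.
Qed.

Lemma mx_columns_sum q k (A : 'M[F]_(q, k)) (c : 'cV[F]_k) :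
  A *m c = \sum_(j < k) c j 0 *: (mx_columns A)`_j.
Proof. by rewrite sum_mx_columns; congr (_ *m _); apply/colP => j; rewrite mxE. Qed.

Lemma rank_col_freeP q k (A : 'M[F]_(q, k)) :
  reflect (forall c : 'cV_k, A *m c = 0 -> c = 0) (\rank A == k).
Proof.
rewrite -mxrank_tr; apply: (iffP idP) => [fA c Ac|inj].
  have : c^T *m A^T = 0 by rewrite -trmx_mul Ac trmx0.
  rewrite -(mul0mx _ A^T) => /(row_free_inj fA) c0.
  by apply: trmx_inj; rewrite c0 trmx0.
rewrite -/(row_free _) -kermx_eq0; apply/eqP/row_matrixP => i.
rewrite row0; apply: trmx_inj; rewrite trmx0; apply: inj.
by apply: trmx_inj; rewrite trmx_mul trmxK -row_mul mulmx_ker row0 trmx0.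
Qed.

Lemma free_mx_columns q k (A : 'M[F]_(q, k)) :
  free (mx_columns A) = (\rank A == k).
Proof.
apply/freeP/rank_col_freeP => [fA c Ac|inj c].
  by apply/colP => j; rewrite (fA (c^~ 0)) ?mxE// -mx_columns_sum.
by rewrite sum_mx_columns => /inj /colP c0 i; have := c0 i; rewrite !mxE.
Qed.

Lemma span_mx_columnsP q k (A : 'M[F]_(q, k)) v :
  reflect (exists c : 'cV_k, v = A *m c) (v \in <<mx_columns A>>%VS).
Proof.
apply: (iffP idP) => [/coord_span ->|[c ->]].
  by rewrite sum_mx_columns; exists (\col_j coord (mx_columns A) j v).
rewrite mx_columns_sum; apply: memv_suml => j _; apply: memvZ.
by apply: memv_span; rewrite mem_nth ?size_tuple.
Qed.

Lemma span_mx_columns_sub k q l (N : 'M[F]_(k, q)) (A : 'M[F]_(q, l)) :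
  (<<mx_columns A>> <= mx_ker N)%VS = (N *m A == 0).
Proof.
apply/idP/eqP => [/subvP sub|NA].
  apply/matrixP => i j; have : col j A \in mx_ker N.
    apply: sub; rewrite -nth_mx_columns; apply: memv_span.
    by rewrite mem_nth ?size_tuple.
  by rewrite mem_mx_ker colE mulmxA -colE => /eqP/colP/(_ i); rewrite !mxE.
apply/subvP => v /span_mx_columnsP[c ->].
by rewrite mem_mx_ker mulmxA NA mul0mx.
Qed.

(** [kermx] is a left kernel, so the transposed row base of [kermx N^T] supplies independent columns
    spanning the right kernel. *)
Lemma dim_mx_ker k q (N : 'M[F]_(k, q)) : \dim (mx_ker N) = (q - \rank N)%N.
Proof.
pose B := (row_base (kermx N^T))^T.
have rB : \rank B = \rank (kermx N^T) by rewrite mxrank_tr; apply/eqP; exact: row_base_free.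
have -> : mx_ker N = <<mx_columns B>>%VS.
  apply/eqP; rewrite eqEsubv span_mx_columns_sub; apply/andP; split.
    apply/subvP => v; rewrite mem_mx_ker => /eqP Nv; apply/span_mx_columnsP.
    have : (v^T <= row_base (kermx N^T))%MS.
      by rewrite eq_row_base; apply/sub_kermxP; rewrite -trmx_mul Nv trmx0.
    by case/submxP => D Dv; exists D^T; rewrite -trmx_mul -Dv trmxK.
  apply/eqP/trmx_inj; rewrite trmx_mul trmxK trmx0; apply/sub_kermxP.
  by rewrite eq_row_base.
have /eqP -> : free (mx_columns B) by rewrite free_mx_columns rB.
by rewrite size_tuple mxrank_ker mxrank_tr.
Qed.

(** By the dimension count, independent columns inside the kernel already span it; the two matrix
    conditions left are stable under field extension. *)
Lemma basis_mx_columns k q r (N : 'M[F]_(k, q)) (B : 'M[F]_(q, r)) :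
  (q - \rank N)%N = r ->
  basis_of (mx_ker N) (mx_columns B) = (N *m B == 0) && (\rank B == r).
Proof.
move=> er; rewrite basisEfree free_mx_columns span_mx_columns_sub.
by rewrite size_tuple dim_mx_ker er leqnn andbT andbC.
Qed.

(** Pick [\rank A] independent columns of [A] and complete them by a basis of a complement of their
    span in the kernel. *)
Lemma extend_columns k q l r (N : 'M[F]_(k, q)) (A : 'M[F]_(q, l)) :
  (q - \rank N)%N = r -> N *m A = 0 ->
  exists (B : 'M[F]_(q, r)) (f : 'I_(\rank A) -> 'I_l) (g : 'I_(\rank A) -> 'I_r),
  [/\ N *m B = 0, \rank B = r, injective f, injective g &
      forall i, col (g i) B = col (f i) A].
Proof.
move=> er NA; move eqs : (\rank A) => s.
have [f injf rf] : exists2 f : 'I_s -> 'I_l, injective f & \rank (colsub f A) = s.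
  move: (maxrankfun A^T) (@maxrankfun_inj _ _ _ A^T) (maxrowsub_free A^T).
  rewrite mxrank_tr eqs => f injf fr; exists f => //.
  rewrite -mxrank_tr; apply/eqP; move: fr; rewrite /row_free.
  by congr (\rank _ == _); apply/matrixP => i j; rewrite !mxE.
pose X0 := mx_columns (colsub f A); pose U := <<X0>>%VS.
have sUV : (U <= mx_ker N)%VS.
  rewrite span_mx_columns_sub; apply/eqP/matrixP => i j.
  have := congr1 (fun M => fun_of_matrix M i (f j)) NA.
  rewrite !mxE => NAij; apply: etrans NAij.
  by apply: eq_bigr => u _; rewrite !mxE.
pose Y := vbasis (mx_ker N :\: U).
have bX : basis_of (mx_ker N) (X0 ++ Y).
  have eV : mx_ker N = (U + (mx_ker N :\: U))%VS.
    apply/eqP; rewrite eqEsubv; apply/andP; split; last first.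
      by rewrite subv_add sUV diffvSl.
    by rewrite -{1}(addv_diff_cap (mx_ker N) U) addvC addvS ?capvSr.
  rewrite {1}eV; apply: cat_basis; last exact: vbasisP.
    by apply/directv_addP; rewrite capvC capv_diff.
  by rewrite /basis_of eqxx free_mx_columns rf eqxx.
have sX : size (X0 ++ Y) = r.
  by rewrite -er -dim_mx_ker (size_basis (X := in_tuple _) bX).
pose B : 'M[F]_(q, r) := \matrix_(i, j) ((X0 ++ Y)`_j i 0).
have sr : (s <= r)%N by rewrite -sX size_cat size_tuple leq_addr.
have BX : mx_columns B = X0 ++ Y :> seq _.
  apply: (@eq_from_nth _ 0); rewrite size_tuple ?sX// => i ir.
  rewrite (nth_mx_columns B (Ordinal ir)); apply/colP => u; by rewrite !mxE.
move: bX; rewrite -BX basis_mx_columns// => /andP[/eqP NB /eqP rB].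
exists B, f, (widen_ord sr); split=> //; first by move=> i j /(congr1 val)/= /val_inj.
move=> i; rewrite -nth_mx_columns BX nth_cat size_tuple /= ltn_ord.
by rewrite nth_mx_columns; apply/colP => u; rewrite !mxE.
Qed.

End MatrixKernels.

(** * Harmonic cycles and bases of the space V *)

Section HarmonicSpaces.
Context {R : realType} {p q : nat}.
Variable G : multigraph p q.
Implicit Type lambda : 'cV[R]_q.

Lemma gram_eq0 k (v : 'cV[R]_k) : (v^T *m v) 0 0 = 0 -> v = 0.
Proof.
rewrite mxE => /eqP; rewrite psumr_eq0 => [/allP v0|i _]; last first.
  by rewrite mxE -expr2 sqr_ge0.
apply/colP => i; have := v0 i (mem_index_enum i).
by rewrite !mxE -expr2 expf_eq0 => /eqP.
Qed.

Lemma gram_ge0 k (v : 'cV[R]_k) : 0 <= (v^T *m v) 0 0.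
Proof. by rewrite mxE sumr_ge0 // => i _; rewrite mxE -expr2 sqr_ge0. Qed.

(** Pairing the Laplacian equation with [lambda] gives a sum of two squared norms equal to 0. *)
Lemma harmonic_cycleP l (bd : 'M[int]_(q, l)) lambda :
  harmonic_cycle G bd lambda ->
  toR (incidence G) *m lambda = 0 /\ (toR bd)^T *m lambda = 0.
Proof.
move=> /(congr1 (fun M => (lambda^T *m M) 0 0)).
rewrite /laplacian mulmxDl mulmxDr mulmx0 !mulmxA -trmx_mul -!mulmxA.
set u := toR _ *m lambda; set v := (toR bd)^T *m lambda.
rewrite mulmxA -{1}[toR bd]trmxK -trmx_mul -/v mxE [RHS]mxE => /eqP.
rewrite paddr_eq0 ?gram_ge0// => /andP[/eqP u0 /eqP v0].
by split; apply: gram_eq0.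
Qed.

Lemma harmonic_cycle_orth l (bd : 'M[int]_(q, l)) lambda (j : 'I_l) :
  harmonic_cycle G bd lambda -> inner lambda (col j (toR bd)) = 0.
Proof.
move=> /harmonic_cycleP[_ /(congr1 (fun M => M^T))].
rewrite trmx_mul trmxK trmx0 /inner colE mulmxA => ->.
by rewrite mul0mx mxE.
Qed.

(** Stacking the two conditions makes V the kernel of one matrix, to which [extend_columns]
    applies. *)
Definition orth_mx lambda : 'M[R]_(p + 1, q) :=
  col_mx (toR (incidence G)) lambda^T.

Lemma ker_incidenceE : ker_incidence G = mx_ker (@toR R _ _ (incidence G)).
Proof. by []. Qed.

Lemma orthVE lambda : orthV G lambda = mx_ker (orth_mx lambda).
Proof.
apply/vspaceP => v; rewrite memv_cap !mem_mx_ker /orth_mx mul_col_mx col_mx_eq0.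
by rewrite andbC.
Qed.

Lemma orth_mx_mul0 l (bd : 'M[int]_(q, l)) lambda :
  incidence G *m bd = 0 -> harmonic_cycle G bd lambda ->
  orth_mx lambda *m toR bd = 0.
Proof.
move=> Gbd /harmonic_cycleP[_ /(congr1 (fun M => M^T))].
rewrite trmx_mul trmxK trmx0 /orth_mx mul_col_mx => ->.
by rewrite /toR -map_mxM Gbd map_mx0 col_mx0.
Qed.

(** Rank-nullity for the form lambda o - on ker d_1: its image lies in a line and is nonzero because
    lambda o lambda is. *)
Lemma dim_orthV lambda :
  toR (incidence G) *m lambda = 0 -> lambda != 0 ->
  (\dim (orthV G lambda)).+1 = \dim (@ker_incidence R _ _ G).
Proof.
move=> Gl l0; rewrite -[RHS](limg_ker_dim (linfun (mulmx lambda^T : 'cV[R]_q -> 'M[R]_1))).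
rewrite [orthV _ _]capvC -[LHS]addn1; congr (_ + _)%N; apply/esym/eqP.
rewrite eqn_leq; apply/andP; split.
  by rewrite (leq_trans (dimvS (subvf _))) // dimvf /dim /= mul1n.
rewrite lt0n dimv_eq0; apply: contra_neq l0 => im0.
have : linfun (mulmx lambda^T : 'cV[R]_q -> 'M[R]_1) lambda \in (0%VS : {vspace 'M[R]_1}).
  by rewrite -im0 memv_img// ker_incidenceE mem_mx_ker Gl.
rewrite memv0 lfunE => /eqP/(congr1 (fun M => fun_of_matrix M 0 0)).
by rewrite [RHS]mxE => /gram_eq0.
Qed.

Lemma dim_orthV_rank lambda :
  (q - \rank (orth_mx lambda))%N = \dim (orthV G lambda).
Proof. by rewrite -dim_mx_ker orthVE. Qed.

Lemma basis_orthVP lambda (B : 'M[R]_(q, \dim (orthV G lambda))) :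
  basis_of (orthV G lambda) (columns B) <->
  orth_mx lambda *m B = 0 /\ \rank B = \dim (orthV G lambda).
Proof.
rewrite {1}orthVE (basis_mx_columns _ (dim_orthV_rank _)).
by split=> [/andP[/eqP -> /eqP ->]|[-> ->]]; rewrite ?eqxx.
Qed.

Lemma exists_good_basis l (bd : 'M[int]_(q, l)) lambda :
  incidence G *m bd = 0 -> harmonic_cycle G bd lambda ->
  exists B : 'M[R]_(q, \dim (orthV G lambda)),
    basis_of (orthV G lambda) (columns B) /\
    includes_columns (\rank (@toR R _ _ bd)) (toR bd) B.
Proof.
move=> Gbd /(orth_mx_mul0 Gbd) Nbd.
have [B [f [g [NB rB fi gi fg]]]] := extend_columns (dim_orthV_rank lambda) Nbd.
by exists B; split; [exact/basis_orthVP|exists f, g].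
Qed.

(* Multiplying column j by the product of its denominators leaves the integral
   columns, in particular those of the given matrix, unchanged. *)
Definition clear_denom k r (B : 'M[rat]_(k, r)) : 'M[int]_(k, r) :=
  \matrix_(i, j) ((\prod_(i' | i' != i) denq (B i' j)) * numq (B i j)).

(** The factor [denq (B i j)] missing from the product is the one that turns [B i j] into
    [numq (B i j)]. *)
Lemma clear_denomE k r (B : 'M[rat]_(k, r)) :
  map_mx intr (clear_denom B) =
  B *m diag_mx (\row_j (\prod_i denq (B i j))%:~R).
Proof.
apply/matrixP => i j; rewrite mul_mx_diag !mxE [X in _ = _ * X%:~R](bigD1 i) //= !intrM mulrA.
by rewrite -numqE mulrC.
Qed.

Lemma clear_denom_id k r l (B : 'M[rat]_(k, r)) (A : 'M[int]_(k, l)) i j :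
  col i B = col j (map_mx intr A) -> col i (clear_denom B) = col j A.
Proof.
move=> /colP BA; apply/colP => u; rewrite !mxE.
have Bint v : B v i = (A v j)%:~R by have := BA v; rewrite !mxE.
by rewrite big1 => [|v _]; rewrite Bint ?denq_int// numq_int mul1r.
Qed.

Lemma rank_clear_denom k r (B : 'M[rat]_(k, r)) :
  \rank (map_mx intr (clear_denom B) : 'M[rat]_(k, r)) = \rank B.
Proof.
rewrite clear_denomE mxrankMfree // row_free_unit unitmxE det_diag unitfE.
apply/prodf_neq0 => j _; rewrite mxE intr_eq0; apply/prodf_neq0 => i _.
exact: denq_neq0.
Qed.

Lemma toR_ratr k r (A : 'M[int]_(k, r)) :
  toR A = map_mx ratr (map_mx intr A : 'M[rat]_(k, r)) :> 'M[R]_(k, r).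
Proof. by apply/matrixP => i j; rewrite !mxE ratr_int. Qed.

Lemma rank_toR k r (A : 'M[int]_(k, r)) :
  \rank (toR A : 'M[R]_(k, r)) = \rank (map_mx intr A : 'M[rat]_(k, r)).
Proof. by rewrite toR_ratr mxrank_map. Qed.

(** For rational [lambda] the matrix [orth_mx lambda] comes from one over [rat]. Ranks do not change
    under field extension, so the columns can be completed over [rat]; rescaling them to integers
    keeps the kernel condition, the rank and the selected columns of [bd]. *)
Lemma exists_integral_good_basis l (bd : 'M[int]_(q, l)) (lambdaQ : 'cV[rat]_q) :
  let lambda : 'cV[R]_q := map_mx ratr lambdaQ in
  incidence G *m bd = 0 -> harmonic_cycle G bd lambda ->
  exists D : 'M[int]_(q, \dim (orthV G lambda)),
    basis_of (orthV G lambda) (columns (toR D)) /\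
    includes_columns (\rank (@toR R _ _ bd)) (toR bd : 'M[R]_(q, l)) (toR D).
Proof.
move=> lambda Gbd /(orth_mx_mul0 Gbd) Nbd.
pose N : 'M[rat]_(p + 1, q) := col_mx (map_mx intr (incidence G)) lambdaQ^T.
have eN : orth_mx lambda = map_mx ratr N.
  by rewrite /orth_mx toR_ratr map_col_mx -map_trmx.
have dimN : (q - \rank N)%N = \dim (orthV G lambda).
  by rewrite -dim_orthV_rank eN mxrank_map.
have NA : N *m map_mx intr bd = 0.
  by apply: (map_mx_inj (f := ratr : rat -> R)); rewrite map_mxM map_mx0 -eN -toR_ratr.
have [B [f [g [NB rB fi gi fg]]]] := extend_columns dimN NA.
exists (clear_denom B); split.
  apply/basis_orthVP; split; last by rewrite rank_toR rank_clear_denom.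
  by rewrite eN toR_ratr -map_mxM clear_denomE mulmxA NB mul0mx map_mx0.
rewrite rank_toR; exists f, g; split=> // i.
have := clear_denom_id (fg i) => /colP eqc.
by apply/colP => u; have := eqc u; rewrite !mxE => ->.
Qed.

End HarmonicSpaces.

(** * Flows, simple cycles and spanning trees *)

Section Walks.
Context {p q : nat}.
Variable G : multigraph p q.

Fixpoint walk (u : 'I_p) (s : seq (dart (q := q))) (v : 'I_p) : bool :=
  if s is d :: s' then (dtail G d == u) && walk (dhead G d) s' v else u == v.

Lemma walk_cat u s v t w : walk u s v -> walk v t w -> walk u (s ++ t) w.
Proof.
elim: s u => [|d s IH] u /= => [/eqP ->//|/andP[-> sv] vw].
exact: IH.
Qed.

Definition rev_walk (s : seq (dart (q := q))) : seq (dart (q := q)) :=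
  rev [seq (d.1, ~~ d.2) | d <- s].

Lemma walk_rev u s v : walk u s v -> walk v (rev_walk s) u.
Proof.
elim: s u => [|[e b] s IH] u /=; first by rewrite eq_sym.
move=> /andP[/eqP tu /IH sv]; rewrite /rev_walk /= rev_cons -cats1.
apply: walk_cat sv _; rewrite /= -tu /dtail /dhead /=.
by case: b {tu}; rewrite /= !eqxx.
Qed.

Lemma walk_vector_nil : walk_vector [::] = 0 :> 'cV[int]_q.
Proof. by rewrite /walk_vector big_nil. Qed.

Lemma walk_vector_cons (d : dart (q := q)) s : walk_vector (d :: s) =
  (if d.2 then 1 else -1) *: delta_mx d.1 0 + walk_vector s :> 'cV[int]_q.
Proof. by rewrite /walk_vector big_cons. Qed.

Lemma walk_vector_cat (s t : seq (dart (q := q))) :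
  walk_vector (s ++ t) = walk_vector s + walk_vector t.
Proof. by rewrite /walk_vector big_cat. Qed.

Lemma walk_vector_rev (s : seq (dart (q := q))) :
  walk_vector (rev_walk s) = - walk_vector s.
Proof.
elim: s => [|[e b] s IH]; first by rewrite walk_vector_nil oppr0.
rewrite /rev_walk /= rev_cons -cats1 walk_vector_cat -/(rev_walk s) IH.
rewrite !walk_vector_cons walk_vector_nil addr0 opprD addrC; congr (_ + _).
by case: b => /=; rewrite !scaleN1r ?scale1r ?opprK.
Qed.

Lemma boundary_walk u s v : walk u s v ->
  incidence G *m walk_vector s = delta_mx v 0 - delta_mx u 0.
Proof.
elim: s u => [|[e b] s IH] u /=.
  by move=> /eqP ->; rewrite walk_vector_nil mulmx0 subrr.
move=> /andP[/eqP tu /IH sv]; rewrite walk_vector_cons mulmxDr sv -scalemxAr.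
rewrite -colE -tu addrC -addrA; congr (_ + _); apply/colP => w.
rewrite !mxE eqxx !andbT /dtail /dhead /=.
by case: b {tu sv} => /=; ring.
Qed.

Lemma walk_vector_notin (s : seq (dart (q := q))) e :
  e \notin map fst s -> walk_vector s e 0 = 0.
Proof.
elim: s => [|d s IH]; first by rewrite walk_vector_nil mxE.
rewrite inE negb_or => /andP[ed /IH es].
by rewrite walk_vector_cons !mxE eqxx andbT es (negbTE ed) mulr0 addr0.
Qed.

Lemma walk_vector_sqr (s : seq (dart (q := q))) e :
  uniq (map fst s) -> e \in map fst s -> walk_vector s e 0 ^+ 2 = 1.
Proof.
elim: s => [//|d s IH] /= /andP[ds us]; rewrite walk_vector_cons !mxE eqxx andbT.
rewrite inE; case: eqP => [->|_ /=].
  by rewrite walk_vector_notin //= mulr1 addr0 => _; case: d.2; rewrite ?sqrrN expr1n.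
by rewrite mulr0 add0r; exact: IH.
Qed.

Lemma simple_cycle_walk s : simple_cycle G s -> exists u, walk u s u.
Proof.
case: s => [|d s] /and4P[// _ /= ds _ _]; exists (dtail G d).
(* [path.cycle] repeats the first dart at the end; for the induction this closing dart must vary
   independently of the starting dart [d1]. *)
rewrite eqxx /=; have : forall d1, path (fun a b => dhead G a == dtail G b) d1 (rcons s d) ->
    walk (dhead G d1) s (dtail G d); last exact.
move: {ds} d; elim: s => [|d' s IH] d d1 /=; first by rewrite andbT.
by move=> /andP[/eqP -> /IH ->]; rewrite eqxx.
Qed.

Lemma connect_walk (Y : {set 'I_q}) u v :
  fingraph.connect (adjacent_in G Y) u v ->
  exists2 s, walk u s v & {subset map fst s <= Y}.
Proof.
case/connectP => t; elim: t u => [|w t IH] u /=.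
  by move=> _ ->; exists [::] => //=.
move=> /andP[/existsP[e /andP[eY uw]] wt lv].
have [s ws sY] := IH _ wt lv.
case/orP: uw => /andP[/eqP te /eqP he].
- exists ((e, true) :: s); first by rewrite /= /dtail /dhead /= te he eqxx.
  by move=> f; rewrite inE => /predU1P[->|/sY].
- exists ((e, false) :: s); first by rewrite /= /dtail /dhead /= te he eqxx.
  by move=> f; rewrite inE => /predU1P[->|/sY].
Qed.

End Walks.

Section Flows.
Context {R : realType} {p q : nat}.
Variable G : multigraph p q.
Implicit Types (z : 'cV[R]_q) (Y T : {set 'I_q}).

Definition flow z : Prop := toR (incidence G) *m z = 0.

Definition supported z Y : Prop := forall e, e \notin Y -> z e 0 = 0.

Lemma flow_comb (a b : R) z z' : flow z -> flow z' -> flow (a *: z - b *: z').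
Proof.
by rewrite /flow => z0 z0'; rewrite mulmxBr -!scalemxAr z0 z0' !scaler0 subr0.
Qed.

(** A coboundary is orthogonal to every cycle: evaluate [h] on the zero boundary of [z]. *)
Lemma flow_potential z (h : 'I_p -> R) :
  flow z -> \sum_e (h (Defs.head G e) - h (tail G e)) * z e 0 = 0.
Proof.
move=> /(congr1 (fun M => ((\row_v h v) *m M) 0 0)).
rewrite mulmx0 mulmxA [RHS]mxE => /(etrans _); apply; rewrite mxE.
apply: eq_bigr => e _.
congr (_ * _); rewrite mxE.
under eq_bigr do rewrite !mxE rmorphB mulrBr.
rewrite big_split /= (bigD1 (Defs.head G e)) //= eqxx mulr1 big1 => [|i /negPf ->]; last first.
  by rewrite mulr0.
rewrite addr0; congr (_ + _); rewrite (bigD1 (tail G e)) //= eqxx mulr1 big1.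
  by rewrite addr0.
by move=> i /negPf ->; rewrite mulr0 oppr0.
Qed.

(** With its converse below, this turns connectivity into a statement on potentials, which combines
    with [flow_potential]. *)
Lemma connected_potential Y (h : 'I_p -> R) :
  connected_spanning G Y -> (forall e, e \in Y -> h (tail G e) = h (Defs.head G e)) ->
  forall u v, h u = h v.
Proof.
move=> [_ cY] hY u v; have /connectP[t] := cY u v.
elim: t u => [|w t IH] u /=; first by move=> _ ->.
move=> /andP[/existsP[e /andP[eY uw]] wt lv]; rewrite -(IH _ wt lv).
by case/orP: uw => /andP[/eqP <- /eqP <-]; rewrite hY.
Qed.

Lemma connected_of_potential Y : (0 < p)%N ->
  (forall h : 'I_p -> R, (forall e, e \in Y -> h (tail G e) = h (Defs.head G e)) ->
    forall u v, h u = h v) -> connected_spanning G Y.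
Proof.
move=> p0 cY; split=> // u v.
(* The indicator of the component of [u] is constant along the edges of [Y]. *)
pose h w : R := (fingraph.connect (adjacent_in G Y) u w)%:R.
have : h u = h v.
  apply: cY => e eY; congr (_%:R); congr nat_of_bool.
  have sym : connect_sym (adjacent_in G Y).
    apply: sym_connect_sym => a b; apply: eq_existsb => f.
    by rewrite orbC.
  apply: same_connect_r => //; apply: connect1; apply/existsP; exists e.
  by rewrite eY !eqxx.
by rewrite /h connect0; case: fingraph.connect => // /eqP; rewrite oner_eq0.
Qed.

(** An edge carrying flow is not a bridge: if [h] does not jump along the other edges, orthogonality
    to [z] leaves [z e 0] times the jump along [e], which must vanish. *)
Lemma connected_remove Y z e : connected_spanning G Y ->
  flow z -> supported z Y -> z e 0 != 0 -> connected_spanning G (Y :\ e).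
Proof.
move=> cY fz zY ze; apply: connected_of_potential; first by case: cY.
move=> h hY; apply: (connected_potential cY) => f fY.
have [->|fe] := eqVneq f e; last by apply: hY; rewrite !inE fe.
have := flow_potential h fz; rewrite (bigD1 e) //= big1 => [|f' f'e].
  move=> /eqP; rewrite addr0 mulf_eq0 (negbTE ze) orbF subr_eq0.
  by move=> /eqP.
have [f'Y|/zY ->] := boolP (f' \in Y); last by rewrite mulr0.
by rewrite hY ?inE ?f'e// subrr mul0r.
Qed.

(* Follow a positive dart out of each vertex: by conservation one can always
   continue, so the iteration closes up. *)
Lemma flow_simple_cycle z : flow z -> z != 0 ->
  exists2 s, simple_cycle G s & {in map fst s, forall e, z e 0 != 0}.
Proof.
move=> fz z0; pose pos (d : dart (q := q)) := if d.2 then 0 < z d.1 0 else z d.1 0 < 0.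
(* If no positive dart left [v], every term of [flow_potential] for the indicator of [v] would be
   nonnegative, and that of the incoming dart [d] positive. *)
have next d : pos d -> exists2 d', pos d' & dtail G d' = dhead G d.
  move=> pd; apply: contrapT => nex.
  pose v := dhead G d.
  have noutp e : 0 < z e 0 -> (tail G e == v) = false.
    by move=> ze; apply/eqP => tv; apply: nex; exists (e, true).
  have noutn e : z e 0 < 0 -> (Defs.head G e == v) = false.
    by move=> ze; apply/eqP => hv; apply: nex; exists (e, false).
  have := flow_potential (fun w => (w == v)%:R) fz => /eqP.
  rewrite psumr_eq0 => [/allP /(_ d.1 (mem_index_enum _)) /=|e _].
    case: d pd @v noutp noutn {nex} => e []; rewrite /pos /dhead /= => ze noutp noutn.
      by rewrite eqxx noutp// subr0 mul1r gt_eqF.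
    by rewrite eqxx noutn// sub0r mulN1r oppr_eq0 lt_eqF.
  have [ze|ze|->] := ltrgt0P (z e 0); last by rewrite mulr0.
    by rewrite noutp// subr0 mulr_ge0// ltW.
  by rewrite noutn// sub0r mulNr oppr_ge0 mulr_ge0_le0// ltW.
have [d0 pd0] : exists d, pos d.
  have /cV0Pn[e ze] := z0; have [ze0|ze0|ze0] := ltrgt0P (z e 0).
  - by exists (e, true).
  - by exists (e, false).
  - by rewrite ze0 eqxx in ze.
pose out v := odflt d0 [pick d | pos d && (dtail G d == v)].
pose W : pred 'I_p := fun v => [exists d, pos d && (dtail G d == v)].
have outP v : W v -> pos (out v) /\ dtail G (out v) = v.
  move=> /existsP[d dv]; rewrite /out; case: pickP => [d' /andP[? /eqP ?]//|].
  by move=> /(_ d); rewrite dv.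
pose phi v := dhead G (out v).
have phiW v : W v -> W (phi v).
  move=> /outP[/next[d pd dv] _]; apply/existsP; exists d.
  by rewrite pd dv eqxx.
have iterW n v : W v -> W (iter n phi v) by move=> Wv; elim: n => //= n; exact: phiW.
have W0 : W (dtail G d0) by apply/existsP; exists d0; rewrite pd0 eqxx.
(* The trajectory may have a tail before its loop. It returns to its [i]-th iterate after
   [order - i] steps, so the orbit of that iterate is a cycle. *)
have [x Wx cx] : exists2 x, W x & fcycle phi (fingraph.orbit phi x).
  have /trajectP[i io eqi] := looping_order phi (dtail G d0).
  exists (iter i phi (dtail G d0)); first exact: iterW.
  apply: (iffRL (orbitPcycle 0 3)).
  exists (fingraph.order phi (dtail G d0) - i.+1)%N.
  rewrite (subnSK io) -iterD subnK; [exact: eqi|exact: ltnW].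
have allW : {in fingraph.orbit phi x, forall v, W v}.
  by move=> v /trajectP[i _ ->]; exact: iterW.
exists (map out (fingraph.orbit phi x)).
  apply/and4P; split.
  - by rewrite -size_eq0 size_map size_traject -lt0n order_gt0.
  - rewrite cycle_map; apply: (sub_in_cycle (P := [in fingraph.orbit phi x]) _ _ cx) => [v w vo wo /eqP <-|].
      by rewrite /= /phi (outP _ (phiW _ (allW _ vo))).2.
    by apply/allP.
  - rewrite -map_comp map_id_in ?orbit_uniq// => v /allW /outP[_].
    by [].
  (* The direction of a positive dart is the sign of [z] on its edge, so the edge determines the
     dart and with it the vertex. *)
  - rewrite -map_comp map_inj_in_uniq ?orbit_uniq// => v w /allW /outP[pv tv].
    move=> /allW /outP[pw tw] /= vw; rewrite -tv -tw; congr (dtail G _).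
    move: pv pw vw {tv tw}; rewrite /pos; case: (out v) (out w) => [e []] [f []] //=.
    + by move=> _ _ ->.
    + by move=> + + ef; rewrite ef => /lt_gtF ->.
    + by move=> + + ef; rewrite ef => /lt_gtF ->.
    + by move=> _ _ ->.
rewrite -map_comp => e /mapP[v /allW /outP[+ _] ->] /=; rewrite /pos.
by case: (out v) => f [] /=; move=> h; rewrite ?(gt_eqF h) ?(lt_eqF h).
Qed.

Definition spanning_tree T : Prop := connected_spanning G T /\
  forall s, simple_cycle G s -> ~~ ([set e in map fst s] \subset T)%SET.

(** A nonzero flow has a simple cycle inside its support, and a tree contains none. Hence flows that
    agree off a tree are equal. *)
Lemma spanning_tree_flow T z : spanning_tree T -> flow z -> supported z T -> z = 0.
Proof.
move=> [_ aT] fz zT; apply: contrapT => /eqP /(flow_simple_cycle fz)[s /aT + zs].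
move=> /negP; apply; apply/fintype.subsetP => e; rewrite inE => /zs.
by apply: contraNT => /zT ->.
Qed.

Lemma toR_eq0 k (A : 'M[int]_(k, 1)) i : (toR A i 0 == 0 :> R) = (A i 0 == 0).
Proof. by rewrite mxE intr_eq0. Qed.

Lemma flow_walk u s : walk G u s u -> flow (toR (walk_vector s)).
Proof.
by move=> /boundary_walk; rewrite subrr /flow /toR -map_mxM => ->; rewrite map_mx0.
Qed.

Lemma simple_cycle_flow s : simple_cycle G s -> flow (toR (walk_vector s)).
Proof. by move=> /simple_cycle_walk[u /flow_walk]. Qed.

Lemma simple_cycle_support s e : simple_cycle G s ->
  (walk_vector s e 0 != 0) = (e \in map fst s).
Proof.
move=> /and4P[_ _ _ us]; have [es|es] := boolP (e \in map fst s).
  by rewrite -sqrf_eq0 walk_vector_sqr.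
by rewrite walk_vector_notin// eqxx.
Qed.

(** Closing up a walk in [T] between the ends of [e] gives a flow with coefficient 1 at [e], hence a
    cycle in its support. Every cycle in T + e passes through [e], so the combination of two of them
    that vanishes at [e] is a flow on [T], hence zero, and their supports agree. *)
Lemma cycletree_add T e : spanning_tree T -> e \notin T -> cycletree G (e |: T)%SET.
Proof.
move=> tT eT; have [[p0 cT] aT] := tT; split.
  split=> // u v; apply: connect_sub (cT u v) => a b /existsP[f /andP[fT ab]].
  by apply: connect1; apply/existsP; exists f; rewrite inE fT orbT.
have [s ws sT] := connect_walk (cT (Defs.head G e) (tail G e)).
have wes : walk G (tail G e) ((e, true) :: s) (tail G e) by rewrite /= eqxx.
have zeT f : f \notin (e |: T)%SET -> f \notin map fst ((e, true) :: s).
  rewrite !inE !negb_or => /andP[-> fT]; apply: contra fT; exact: sT.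
have ze : walk_vector ((e, true) :: s) e 0 = 1.
  rewrite walk_vector_cons !mxE !eqxx mulr1 walk_vector_notin ?addr0//.
  by apply: contra eT; exact: sT.
have [|c cc csub] := flow_simple_cycle (flow_walk wes).
  by apply/cV0Pn; exists e; rewrite toR_eq0 ze.
exists [set f in map fst c]%SET; split.
  split; first by exists c.
  apply/fintype.subsetP => f; rewrite inE => /csub; rewrite toR_eq0.
  by apply: contraNT => /zeT /walk_vector_notin ->.
have thru s' : simple_cycle G s' -> ([set f in map fst s'] \subset e |: T)%SET ->
    walk_vector s' e 0 != 0.
  move=> cs' sub; rewrite simple_cycle_support//; apply: contraT => es'.
  have /negP[] := aT _ cs'; apply/fintype.subsetP => f fs'.
  have := fintype.subsetP sub f fs'; rewrite !inE => /predU1P[fe|//].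
  by move: fs'; rewrite inE fe (negbTE es').
move=> C [[s' cs' ->] sub'].
have subc : ([set f in map fst c] \subset e |: T)%SET.
  apply/fintype.subsetP => f; rewrite inE => /csub; rewrite toR_eq0.
  by apply: contraNT => /zeT /walk_vector_notin ->.
have := spanning_tree_flow tT (flow_comb (toR (walk_vector s') e 0)
  (toR (walk_vector c) e 0) (simple_cycle_flow cc) (simple_cycle_flow cs')).
have h0 : supported (toR (walk_vector s') e 0 *: toR (walk_vector c) -
    toR (walk_vector c) e 0 *: toR (walk_vector s')) T.
  move=> f fT; rewrite !mxE; have [->|fe] := eqVneq f e; first by rewrite mulrC subrr.
  have notin s0 : ([set f in map fst s0] \subset e |: T)%SET -> walk_vector s0 f 0 = 0.
    move=> /fintype.subsetP /(_ f); rewrite !inE (negbTE fe) (negbTE fT) /= => ns.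
    by apply: walk_vector_notin; apply/negP => /ns.
  by rewrite !notin// !mulr0 subrr.
move=> /(_ h0) /colP eq0; apply/setP => f; rewrite !inE.
rewrite -!simple_cycle_support// -!(toR_eq0 _ f); have /eqP := eq0 f.
rewrite !mxE subr_eq0 => /eqP eqf.
have := thru _ cc subc; have := thru _ cs' sub'; rewrite -!(intr_eq0 R) => ns' nc.
have := congr1 (fun x => x == 0) eqf; rewrite !mulf_eq0 (negbTE ns') (negbTE nc) /=.
by move=> ->.
Qed.


(** A connected spanning edge set of minimal size contains no cycle, since deleting an edge of a
    cycle does not disconnect. *)
Lemma spanning_tree_exists : connected_graph G -> exists T, spanning_tree T.
Proof.
move=> cG; pose P T := `[< connected_spanning G T >].
have PT : P [set: 'I_q]%SET by apply/asboolP.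
pose T := [arg min_(T < [set: 'I_q]%SET | P T) #|T|].
exists T; rewrite /T; case: arg_minnP => //= {T}T /asboolP cT minT; split=> // s cs.
apply/negP => sT.
have [e es] : exists e, e \in map fst s.
  by case: s cs {sT} => [/and4P[]//|d s _]; exists d.1; rewrite inE eqxx.
have : P (T :\ e)%SET.
  apply/asboolP; apply: connected_remove cT (simple_cycle_flow cs) _ _.
    move=> f fT; apply/eqP; rewrite toR_eq0 walk_vector_notin//.
    by apply: contra fT => fs; apply: (fintype.subsetP sT); rewrite inE.
  by rewrite toR_eq0 simple_cycle_support.
move=> /minT; rewrite (cardsD1 e T) (fintype.subsetP sT) ?inE//.
by rewrite add1n ltnn.
Qed.

(** * Fundamental cycles and the sum over cycletrees *)

Section CycletreeSum.
Variable zY : {set 'I_q} -> 'cV[int]_q.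
Hypothesis zYP : forall Y, cycletree G Y -> is_cycle_vector G Y (zY Y).
Let zR Y : 'cV[R]_q := toR (zY Y).

(** The edge [e] lies on the only cycle of [Y], so it is not a bridge, and a cycle avoiding it would
    be a second one. *)
Lemma cycletree_remove Y e : cycletree G Y -> zR Y e 0 != 0 ->
  e \in Y /\ spanning_tree (Y :\ e).
Proof.
move=> tY; have [s cs [sY ez]] := zYP tY; rewrite /zR toR_eq0 ez => ze.
have es : e \in map fst s by rewrite -simple_cycle_support.
have eY : e \in Y by apply: (fintype.subsetP sY); rewrite inE.
split=> //; have [cY [C [_ uC]]] := tY; split.
  apply: (connected_remove cY (simple_cycle_flow cs)); last by rewrite toR_eq0.
  move=> f fT; apply/eqP; rewrite toR_eq0 walk_vector_notin//.
  by apply: contra fT => fs; apply: (fintype.subsetP sY); rewrite inE.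
move=> c cc; apply/negP => cYe.
have eqC : [set f in map fst s]%SET = [set f in map fst c]%SET.
  rewrite -(uC _ (conj (ex_intro2 _ _ s cs erefl) sY)).
  apply: uC; split; first by exists c.
  by exact: fintype.subset_trans cYe (finset.subsetDl _ _).
have := fintype.subsetP cYe e; rewrite -eqC !inE eqxx es => /(_ isT).
by [].
Qed.

(** A cycle vector vanishing at [e] would be a flow on the tree, hence zero. The square is
    independent of the orientation chosen by [zY]. *)
Lemma cycletree_add_vector T e : spanning_tree T -> e \notin T ->
  [/\ flow (zR (e |: T)%SET), supported (zR (e |: T)%SET) (e |: T)%SET &
      zR (e |: T)%SET e 0 ^+ 2 = 1].
Proof.
move=> tT eT; have tY := cycletree_add tT eT.
have [s cs [sY ez]] := zYP tY; rewrite /zR ez.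
have sup : supported (toR (walk_vector s)) (e |: T)%SET.
  move=> f fT; apply/eqP; rewrite toR_eq0 walk_vector_notin//.
  by apply: contra fT => fs; apply: (fintype.subsetP sY); rewrite inE.
split=> //; first exact: simple_cycle_flow.
rewrite mxE -rmorphXn walk_vector_sqr//; first by case/and4P: cs.
rewrite -simple_cycle_support// -(toR_eq0 _ e); apply/negP => /eqP ze0.
have zs : toR (walk_vector s) = 0 :> 'cV[R]_q.
  apply: (spanning_tree_flow tT); first exact: simple_cycle_flow.
  move=> f fT; have [->//|fe] := eqVneq f e.
  by apply: sup; rewrite !inE negb_or fe.
case: s cs {sY ez sup ze0} zs => [/and4P[]//|d s cs] /colP/(_ d.1)/eqP.
rewrite [X in _ == X]mxE toR_eq0; apply/negP.
by rewrite simple_cycle_support// mem_head.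
Qed.

(* Off the tree, a fundamental cycle is +1 or -1 at its own edge and 0 at all
   others, and a flow is determined by its values there. *)
Lemma fundamental_expansion T x : spanning_tree T -> flow x ->
  \sum_(e | e \notin T) (x e 0 * zR (e |: T)%SET e 0) *: zR (e |: T)%SET = x.
Proof.
move=> tT fx; apply/eqP; rewrite eq_sym -subr_eq0; apply/eqP.
apply: (spanning_tree_flow tT).
  rewrite /flow mulmxBr fx mulmx_sumr big1 ?subrr// => e eT.
  have [fe _ _] := cycletree_add_vector tT eT.
  by rewrite -scalemxAr fe scaler0.
move=> f fT; rewrite mxE [X in _ + X]mxE summxE (bigD1 f)//= big1 => [|e /andP[eT ef]].
  have [_ _ f2] := cycletree_add_vector tT fT.
  by rewrite addr0 mxE -mulrA -expr2 f2 mulr1 subrr.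
have [_ sup _] := cycletree_add_vector tT eT.
rewrite mxE (sup f) ?mulr0// in_setU1 negb_or fT andbT.
by rewrite eq_sym.
Qed.

Lemma cycletree_sum x : flow x ->
  \sum_(Y | `[< cycletree G Y >]) inner x (zR Y) *: zR Y =
  #|[set T | `[< spanning_tree T >]]%SET|%:R *: x.
Proof.
(* Expand the inner product over the edges; only those of the cycle of [Y] have a nonzero
   coefficient. *)
move=> fx; transitivity (\sum_e \sum_(Y | `[< cycletree G Y >] && (zR Y e 0 != 0))
    (x e 0 * zR Y e 0) *: zR Y).
  rewrite (exchange_big_dep (fun Y => `[< cycletree G Y >])) => [|e Y _ /andP[]//].
  rewrite [LHS](eq_bigr (fun Y => \sum_e (x e 0 * zR Y e 0) *: zR Y)).
    apply: eq_bigr => Y tY; rewrite (bigID (fun e => zR Y e 0 != 0)) /= [X in _ + X]big1 ?addr0.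
      by apply: eq_bigl => e; rewrite tY.
    by move=> e /negPn/eqP ->; rewrite mulr0 scale0r.
  move=> Y _; rewrite -scaler_suml; congr (_ *: _); rewrite /inner mxE.
  by apply: eq_bigr => e _; rewrite mxE.
(* For fixed [e], adding and deleting [e] are inverse bijections between the trees avoiding [e] and
   the cycletrees whose cycle contains [e]. *)
transitivity (\sum_e \sum_(T | `[< spanning_tree T >] && (e \notin T))
    (x e 0 * zR (e |: T)%SET e 0) *: zR (e |: T)%SET).
  apply: eq_bigr => e _.
  rewrite (reindex_onto (fun T => e |: T)%SET (fun Y => Y :\ e)%SET) /=; last first.
    by move=> Y /andP[/asboolP tY /(cycletree_remove tY)[eY _]]; rewrite finset.setD1K.
  apply: eq_bigl => T; apply/andP/andP.
    move=> [/andP[/asboolP tY ze] /eqP eT].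
    have [_] := cycletree_remove tY ze; rewrite eT => tT; split; first exact/asboolP.
    by rewrite -eT !inE eqxx.
  move=> [/asboolP tT eT]; rewrite finset.setU1K// eqxx; split=> //.
  apply/andP; split; first by apply/asboolP; exact: cycletree_add.
  have [_ _ z2] := cycletree_add_vector tT eT.
  by rewrite -sqrf_eq0 z2 oner_eq0.
rewrite (exchange_big_dep (fun T => `[< spanning_tree T >])) => [|e T _ /andP[]//].
rewrite (eq_bigr (fun=> x)) => [|T tT]; last first.
  have /asboolP sT := tT; rewrite -[RHS](fundamental_expansion sT fx).
  by apply: eq_bigl => e; rewrite tT.
rewrite sumr_const -scaler_nat; congr (_%:R *: _).
by apply: eq_card => T; rewrite !inE.
Qed.

End CycletreeSum.

End Flows.

(** * The winding number *)

Section Winding.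
Context {R : realType} {p q : nat}.
Variable G : multigraph p q.

(** A rational relation between the columns becomes integral after clearing denominators, and
    uniqueness of the coordinates of 0 makes it trivial. The rank is the same over [rat] and over
    [R]. *)
Lemma rank_Z1_basis m (beta : 'M[int]_(q, m)) :
  Z1_basis G beta -> \rank (toR beta : 'M[R]_(q, m)) = m.
Proof.
move=> [Gb ub]; rewrite rank_toR; apply/eqP/rank_col_freeP => c bc.
apply/eqP; rewrite -mxrank_eq0 -rank_clear_denom mxrank_eq0.
have bc0 : beta *m clear_denom c = 0.
  have /matrixP bc0 : map_mx intr (beta *m clear_denom c) = 0 :> 'cV[rat]_q.
    by rewrite map_mxM clear_denomE mulmxA bc mul0mx.
  by apply/matrixP => i j; apply/eqP; have /eqP := bc0 i j; rewrite !mxE intr_eq0.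
have [c' [_ uc']] : exists! c' : 'cV_m, 0 = beta *m c' by apply: ub; rewrite mulmx0.
have -> : clear_denom c = 0.
  by rewrite -(uc' _ (esym bc0)); apply: uc'; rewrite mulmx0.
by rewrite map_mx0.
Qed.

Lemma coords_mulmx m k l (beta : 'M[int]_(q, m)) (A : 'M[R]_(q, k)) (C : 'M[R]_(k, l)) :
  coords beta (A *m C) = coords beta A *m C.
Proof.
apply/matrixP => i j; rewrite !mxE.
have -> : col j (A *m C) = \sum_k0 C k0 j *: col k0 A.
  apply/colP => u; rewrite summxE !mxE; apply: eq_bigr => v _.
  by rewrite !mxE mulrC.
by rewrite linear_sum; apply: eq_bigr => u _; rewrite linearZ mxE mulrC.
Qed.

Lemma coords_row_mx m k l (beta : 'M[int]_(q, m)) (A : 'M[R]_(q, k)) (B : 'M[R]_(q, l)) :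
  coords beta (row_mx A B) = row_mx (coords beta A) (coords beta B).
Proof.
apply/matrixP => i j; case: (split_ordP j) => u ->.
  by rewrite row_mxEl !mxE colKl.
by rewrite row_mxEr !mxE colKr.
Qed.

(** The columns of [beta] are independent over [R] and as many as the dimension of the real cycle
    space, so the Z-basis is a real basis as well. *)
Lemma mulmx_coords m k (beta : 'M[int]_(q, m)) (A : 'M[R]_(q, k)) :
  Z1_basis G beta -> m = \dim (@ker_incidence R _ _ G) ->
  toR (incidence G) *m A = 0 -> toR beta *m coords beta A = A.
Proof.
move=> Zb em GA; apply/matrixP => i j.
have dimE : (q - \rank (@toR R _ _ (incidence G)))%N = m.
  by rewrite em -dim_mx_ker.
have bb : basis_of (mx_ker (toR (incidence G))) (mx_columns (toR beta : 'M[R]_(q, m))).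
  rewrite basis_mx_columns// rank_Z1_basis// eqxx andbT.
  by rewrite /toR -map_mxM Zb.1 map_mx0.
have Aker : col j A \in mx_ker (toR (incidence G)).
  by rewrite mem_mx_ker colE mulmxA GA mul0mx.
have := coord_basis bb Aker; rewrite sum_mx_columns => /colP/(_ i).
rewrite mxE => ->; rewrite !mxE; apply: eq_bigr => u _; congr (_ * _).
by rewrite !mxE.
Qed.

(** The part of [z] orthogonal to [lambda] lies in V, the span of [bd'], so only the part along
    [lambda] survives in the determinant. At [lambda] itself the determinant is nonzero because
    [lambda] is independent of V. *)
Lemma winding_inner (lambda : 'cV[R]_q) r (beta : 'M[int]_(q, r.+1)) (bd' : 'M[R]_(q, r)) :
  flow G lambda -> lambda != 0 -> r = \dim (orthV G lambda) ->
  Z1_basis G beta -> basis_of (orthV G lambda) (columns bd') ->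
  winding beta bd' lambda != 0 /\
  forall z, flow G z ->
    winding beta bd' z =
    winding beta bd' lambda * (inner lambda z / inner lambda lambda).
Proof.
move=> fl l0 er Zb bbd.
have em : r.+1 = \dim (@ker_incidence R _ _ G) by rewrite er dim_orthV.
have [Nbd rbd] : orth_mx G lambda *m bd' = 0 /\ \rank bd' = r.
  by subst r; apply/basis_orthVP.
move: Nbd; rewrite /orth_mx mul_col_mx => /eqP; rewrite col_mx_eq0.
move=> /andP[/eqP Gbd /eqP lbd].
have ll0 : inner lambda lambda != 0 by apply: contra_neq l0 => /gram_eq0.
have windE z : winding beta bd' z = \det (coords beta (row_mx z bd') : 'M[R]_r.+1).
  by rewrite (coords_row_mx beta z bd').
split.
  rewrite windE -unitfE -unitmxE -row_full_unit /row_full eqn_leq rank_leq_row /=.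
  have rk : \rank (row_mx lambda bd') = r.+1.
    apply/eqP/rank_col_freeP => c; rewrite -[c]vsubmxK mul_row_col => lc.
    (* Pairing with [lambda] kills the columns of [bd'] and isolates the first coefficient. *)
    have := congr1 (mulmx lambda^T) lc; rewrite mulmx0 mulmxDr !mulmxA lbd mul0mx addr0.
    rewrite [lambda^T *m lambda]mx11_scalar mul_scalar_mx => /eqP.
    rewrite scaler_eq0 (negbTE ll0) /= => /eqP c0.
    move: lc; rewrite c0 mulmx0 add0r.
    move/eqP/rank_col_freeP: rbd => /[apply] ->.
    by rewrite col_mx0.
  (* Multiplying by [beta] cannot raise the rank, and the product is the matrix of rank [r.+1]
     itself. *)
  have := mxrankM_maxr (toR beta) (coords beta (row_mx lambda bd')).
  by rewrite (mulmx_coords Zb em) ?rk// mul_mx_row fl Gbd row_mx0.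
move=> z fz; set a := inner lambda z / _.
have zV : z - a *: lambda \in orthV G lambda.
  rewrite orthVE mem_mx_ker /orth_mx mul_col_mx !mulmxBr -!scalemxAr fz fl.
  rewrite scaler0 subr0 [lambda^T *m z]mx11_scalar [lambda^T *m lambda]mx11_scalar.
  by rewrite -/(inner _ _) -/(inner _ _) scale_scalar_mx divfK// subrr col_mx0.
have [c zc] : exists c, z - a *: lambda = bd' *m c.
  by apply/span_mx_columnsP; rewrite (span_basis bbd).
rewrite !windE.
(* Replacing [lambda] by [z] is a column operation with a lower triangular matrix of determinant
   [a]. *)
have -> : row_mx z bd' = row_mx lambda bd' *m block_mx a%:M 0 c 1%:M.
  rewrite mul_row_block mulmx1 mulmx0 add0r -zc mul_mx_scalar.
  by congr row_mx; rewrite addrC subrK.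
by rewrite coords_mulmx det_mulmx [X in _ * X](@det_lblock _ 1 r) det1 mulr1 det_scalar1.
Qed.

Lemma harmonic_cycle_standard (lambda : 'cV[R]_q) r (beta : 'M[int]_(q, r.+1))
    (bd' : 'M[R]_(q, r)) :
  connected_graph G ->
  flow G lambda -> lambda != 0 -> r = \dim (orthV G lambda) ->
  Z1_basis G beta -> basis_of (orthV G lambda) (columns bd') ->
  exists d : R, forall zY : {set 'I_q} -> 'cV[int]_q,
    (forall Y, cycletree G Y -> is_cycle_vector G Y (zY Y)) ->
    lambda = d *: standard_harmonic_cycle G beta bd' zY.
Proof.
move=> cG fl l0 er Zb bbd.
have [w0 wE] := winding_inner fl l0 er Zb bbd.
have ll0 : inner lambda lambda != 0 by apply: contra_neq l0 => /gram_eq0.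
pose N := #|[set T | `[< spanning_tree G T >]]%SET|.
have N0 : N%:R != 0 :> R.
  have [T tT] := spanning_tree_exists (R := R) cG.
  by rewrite pnatr_eq0 -lt0n; apply/card_gt0P; exists T; rewrite inE; apply/asboolP.
pose k := winding beta bd' lambda / inner lambda lambda.
have k0 : k != 0 by rewrite mulf_neq0// invr_neq0.
(* [k] is the ratio of w(z) to lambda o z, and [cycletree_sum] contributes the factor [N]; neither
   depends on [zY]. *)
exists (k * N%:R)^-1 => zY zYP.
have -> : standard_harmonic_cycle G beta bd' zY = k *: (N%:R *: lambda).
  rewrite -(cycletree_sum zYP fl) scaler_sumr; apply: eq_bigr => Y /asboolP /zYP.
  move=> [s cs [_ ->]]; rewrite wE; last exact: simple_cycle_flow.
  by rewrite scalerA /k mulrA mulrAC.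
by rewrite scalerA scalerA -mulrA mulVf ?scale1r// mulf_neq0.
Qed.

End Winding.

(** * Walks in the geometric graph *)

Section ClosedWalks.
Context (R : realType) {p q : nat}.
Variable G : multigraph p q.
Hypothesis cG : connected_graph G.

(** The vectors of closed walks at [v0] form a group containing each [c e], the loop through [e]
    along fixed access paths [g]. In the sum of the [z e 0 *: c e] the access paths cancel by
    conservation. *)
Lemma exists_closed_walk (v0 : 'I_p) (z : 'cV[int]_q) :
  incidence G *m z = 0 -> exists2 s, walk G v0 s v0 & walk_vector s = z.
Proof.
move=> Gz; pose P x := exists2 s, walk G v0 s v0 & walk_vector s = x.
have P0 : P 0 by exists [::]; rewrite ?walk_vector_nil /=.
have PD x y : P x -> P y -> P (x + y).
  move=> [s ws <-] [t wt <-]; exists (s ++ t); first exact: walk_cat wt.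
  by rewrite walk_vector_cat.
have PN x : P x -> P (- x).
  move=> [s ws <-]; exists (rev_walk s); first exact: walk_rev.
  by rewrite walk_vector_rev.
have PZ (a : int) x : P x -> P (a *: x).
  move=> Px; have Pn n : P (x *+ n).
    by elim: n => [|n IH]; rewrite ?mulr0n// mulrS; exact: PD.
  by case: a => n; rewrite ?NegzE ?scaleNr -[_%:Z]natz scaler_nat; auto.
have exg v : exists s, walk G v0 s v.
  by have [s ws _] := connect_walk (cG.2 v0 v); exists s.
have [g gw] := boolp.choice exg.
pose c e := walk_vector (g (tail G e)) + delta_mx e 0 - walk_vector (g (Defs.head G e)).
have Pc e : P (c e).
  exists (g (tail G e) ++ (e, true) :: rev_walk (g (Defs.head G e))).
    by apply: walk_cat (gw _) _; rewrite /= eqxx; exact: walk_rev.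
  rewrite walk_vector_cat walk_vector_cons /= scale1r walk_vector_rev.
  by rewrite /c addrA.
suff -> : z = \sum_e z e 0 *: c e.
  by elim/big_ind: _ => // e _; exact: PZ.
apply/colP => i; rewrite summxE.
have fz : flow G (toR z : 'cV[R]_q) by rewrite /flow /toR -map_mxM Gz map_mx0.
(* For each coordinate [i], the access paths define a potential on the vertices. *)
have := flow_potential (fun v => (walk_vector (g v) i 0)%:~R) fz.
rewrite (eq_bigr (fun e => ((walk_vector (g (Defs.head G e)) i 0 -
  walk_vector (g (tail G e)) i 0) * z e 0)%:~R)); last first.
  by move=> e _; rewrite mxE intrM intrB.
rewrite -rmorph_sum => /eqP; rewrite intr_eq0 => /eqP pot0.
rewrite -[RHS]addr0 -[X in _ = _ + X]pot0 -big_split /= (bigD1 i)//= big1.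
  by rewrite !mxE !eqxx /=; ring.
by move=> e ei; rewrite !mxE eq_sym (negbTE ei) /=; ring.
Qed.

End ClosedWalks.

Lemma continuous_pair (T U V : topologicalType) (f : T -> U) (g : T -> V) :
  continuous f -> continuous g -> continuous (fun x => (f x, g x)).
Proof. by move=> cf cg x; apply: (cvg_pair (cf x) (cg x)). Qed.

(** * Parametrized walks and their lifts to the line *)

Section Skeleton.
Context {R : realType} {p q : nat}.
Variable G : multigraph p q.

(** Truncation to [0, 1], written with absolute values so that continuity comes from that of the
    norm. *)
Definition clamp (t : R) : R := (1 + `|t| - `|t - 1|) / 2.

Lemma clamp_le0 t : t <= 0 -> clamp t = 0.
Proof. by move=> t0; rewrite /clamp !ler0_norm; lra. Qed.

Lemma clamp_ge1 t : 1 <= t -> clamp t = 1.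
Proof. by move=> t1; rewrite /clamp !ger0_norm; lra. Qed.

Lemma clamp_id t : 0 <= t <= 1 -> clamp t = t.
Proof.
by move=> t01; rewrite /clamp (ger0_norm (x := t)) ?(ler0_norm (x := t - 1)); lra.
Qed.

Lemma clamp_continuous : continuous clamp.
Proof.
move=> t; apply: cvgM; last exact: cvg_cst.
apply: cvgB; first apply: cvgD; first exact: cvg_cst.
  exact: norm_continuous.
by apply: cvg_norm; apply: cvgB; [exact: cvg_id|exact: cvg_cst].
Qed.

Definition vertex_pt (v : 'I_p) : R * R * R * R := ((v : nat)%:R, 0, 0, 0).

(* With b = t (1 - t), the last three coordinates b, t b and e b recover t and
   the label e for 0 < t < 1. *)
Definition edge_pt (e : 'I_q) (t : R) : R * R * R * R :=
  ((tail G e : nat)%:R + t * ((Defs.head G e : nat)%:R - (tail G e : nat)%:R),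
   t * (1 - t), t * (t * (1 - t)), (e : nat)%:R * (t * (1 - t))).

Lemma edge_pt0 e : edge_pt e 0 = vertex_pt (tail G e).
Proof. by rewrite /edge_pt /vertex_pt !mul0r mulr0 addr0. Qed.

Lemma edge_pt1 e : edge_pt e 1 = vertex_pt (Defs.head G e).
Proof. by rewrite /edge_pt /vertex_pt subrr !mulr0 mul1r addrC subrK. Qed.

Lemma vertex_pt_inj : injective vertex_pt.
Proof. by move=> v w [/eqP]; rewrite eqr_nat => /eqP/val_inj. Qed.

Lemma edge_pt_neq_vertex e t v : 0 < t < 1 -> edge_pt e t <> vertex_pt v.
Proof. by move=> t01 [_ /eqP]; rewrite mulf_eq0; lra. Qed.

Lemma edge_pt_inj e e' t t' : 0 < t < 1 -> 0 < t' < 1 ->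
  edge_pt e t = edge_pt e' t' -> e = e' /\ t = t'.
Proof.
move=> t01 t01' [_ eb]; rewrite -eb => etb eeb.
have b0 : t * (1 - t) != 0 by rewrite mulf_neq0; lra.
split; last exact: mulIf b0 _ _ etb.
by move/(mulIf b0): eeb => /eqP; rewrite eqr_nat => /eqP/val_inj.
Qed.

Lemma edge_pt_continuous e : continuous (edge_pt e).
Proof.
have ct : continuous (fun t : R => t * (1 - t)).
  by move=> t; apply: cvgM; [exact: cvg_id|apply: cvgB; [exact: cvg_cst|exact: cvg_id]].
apply: continuous_pair; first apply: continuous_pair; first apply: continuous_pair.
- by move=> t; apply: cvgD; [exact: cvg_cst|apply: cvgM; [exact: cvg_id|exact: cvg_cst]].
- exact: ct.
- by move=> t; apply: cvgM; [exact: cvg_id|exact: ct].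
- by move=> t; apply: cvgM; [exact: cvg_cst|exact: ct].
Qed.

Definition dart_pt (d : dart (q := q)) (t : R) :=
  edge_pt d.1 (if d.2 then clamp t else 1 - clamp t).

Lemma dart_pt_continuous d : continuous (dart_pt d).
Proof.
move=> t; apply: continuous_comp; last exact: edge_pt_continuous.
case: d.2; first exact: clamp_continuous.
by apply: cvgB; [exact: cvg_cst|exact: clamp_continuous].
Qed.

Lemma dart_pt_le0 d t : t <= 0 -> dart_pt d t = vertex_pt (dtail G d).
Proof.
move=> t0; rewrite /dart_pt clamp_le0// /dtail subr0.
by case: d.2; rewrite ?edge_pt0 ?edge_pt1.
Qed.

Lemma dart_pt_ge1 d t : 1 <= t -> dart_pt d t = vertex_pt (dhead G d).
Proof.
move=> t1; rewrite /dart_pt clamp_ge1// /dhead subrr.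
by case: d.2; rewrite ?edge_pt0 ?edge_pt1.
Qed.

(* Consecutive pieces are glued by addition: each one is constant outside its
   own unit of time. *)
Fixpoint walk_pt (u : 'I_p) (s : seq (dart (q := q))) (t : R) : R * R * R * R :=
  if s is d :: s' then
    dart_pt d t + (walk_pt (dhead G d) s' (t - 1) - vertex_pt (dhead G d))
  else vertex_pt u.

(** A backward passage lifts to [- clamp t], which agrees with the position [1 - clamp t] modulo 1
    and starts at 0, so that the pieces can be added. *)
Definition dart_lift (e : 'I_q) (d : dart (q := q)) (t : R) : R :=
  if d.1 == e then (if d.2 then clamp t else - clamp t) else 0.

Fixpoint walk_lift (e : 'I_q) (s : seq (dart (q := q))) (t : R) : R :=
  if s is d :: s' then dart_lift e d t + walk_lift e s' (t - 1) else 0.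

Lemma shift1_continuous : continuous (fun t : R => t - 1).
Proof. by move=> t; apply: cvgB; [exact: cvg_id|exact: cvg_cst]. Qed.

Lemma walk_pt_continuous u s : continuous (walk_pt u s).
Proof.
elim: s u => [|d s IH] u; first by move=> t; exact: cvg_cst.
have cs : continuous (fun t : R => walk_pt (dhead G d) s (t - 1)).
  by move=> t; exact: (continuous_comp (@shift1_continuous t) (IH _ _)).
move=> t /=; apply: cvgD; first exact: dart_pt_continuous.
by apply: cvgB; [exact: cs|exact: cvg_cst].
Qed.

Lemma walk_lift_continuous e s : continuous (walk_lift e s).
Proof.
elim: s => [|d s IH]; first by move=> t; exact: cvg_cst.
have cs : continuous (fun t : R => walk_lift e s (t - 1)).
  by move=> t; exact: (continuous_comp (@shift1_continuous t) (IH _)).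
move=> t /=; apply: cvgD; last exact: cs.
rewrite /dart_lift; case: ifP => _; last exact: cvg_cst.
case: d.2; first exact: clamp_continuous.
by apply: cvgN; exact: clamp_continuous.
Qed.

Lemma walk_pt_le0 u s v t : walk G u s v -> t <= 0 -> walk_pt u s t = vertex_pt u.
Proof.
elim: s u t => [//|d s IH] u t /= /andP[/eqP <- ws] t0.
by rewrite (IH _ _ ws) ?subrr ?addr0 ?dart_pt_le0//; lra.
Qed.

Lemma walk_pt_ge u s v t : walk G u s v -> (size s)%:R <= t ->
  walk_pt u s t = vertex_pt v.
Proof.
elim: s u t => [|d s IH] u t /=; first by move=> /eqP ->.
move=> /andP[_ ws]; rewrite -addn1 natrD => ts.
rewrite (IH _ _ ws); last by lra.
have t1 : 1 <= t by have := ler0n R (size s); lra.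
by rewrite (dart_pt_ge1 _ t1) addrC subrK.
Qed.

Lemma walk_lift_le0 e s t : t <= 0 -> walk_lift e s t = 0.
Proof.
elim: s t => [//|d s IH] t t0 /=; rewrite IH; last by lra.
by rewrite /dart_lift clamp_le0// oppr0 addr0; case: ifP => //; case: d.2.
Qed.

(** After its unit of time each dart over [e] keeps contributing its sign, so the lift ends at the
    signed number of passages. *)
Lemma walk_lift_ge e s t : (size s)%:R <= t ->
  walk_lift e s t = (walk_vector s e 0)%:~R.
Proof.
elim: s t => [|d s IH] t /=; first by rewrite walk_vector_nil mxE.
rewrite -addn1 natrD => ts; rewrite IH; last by lra.
rewrite walk_vector_cons !mxE intrD andbT eq_sym; congr (_ + _).
rewrite /dart_lift clamp_ge1; last by have := ler0n R (size s); lra.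
by case: eqP; case: d.2; rewrite ?mulr1 ?mulr0 ?rmorphN.
Qed.

(* The relation [collapse] expressed in the ambient coordinates. *)
Definition collapse_pt (e : 'I_q) (x : R * R * R * R) (y : R) : Prop :=
  (exists t, [/\ 0 < t < 1, edge_pt e t = x & y - t \is a Num.int]) \/
  ((forall t, 0 < t < 1 -> edge_pt e t <> x) /\ y \is a Num.int).

Lemma collapse_pt_shift e x y n :
  n \is a Num.int -> collapse_pt e x y -> collapse_pt e x (n + y).
Proof.
move=> nint [[t [t01 et yt]]|[ne yint]]; [left|right]; last by rewrite rpredD.
by exists t; split=> //; rewrite -addrA rpredD.
Qed.

Lemma collapse_vertex e v y : y \is a Num.int -> collapse_pt e (vertex_pt v) y.
Proof. by move=> yint; right; split=> // t; exact: edge_pt_neq_vertex. Qed.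

Lemma collapse_dart e d t : collapse_pt e (dart_pt d t) (dart_lift e d t).
Proof.
have [t0|t0] := leP t 0.
  rewrite dart_pt_le0//; apply: collapse_vertex; rewrite /dart_lift clamp_le0// oppr0.
  by case: ifP => //; case: d.2.
have [t1|t1] := leP 1 t.
  rewrite dart_pt_ge1//; apply: collapse_vertex; rewrite /dart_lift clamp_ge1//.
  by case: ifP => //; case: d.2; rewrite ?rpredN ?rpred1.
rewrite /dart_pt /dart_lift clamp_id; last by lra.
case: d => f b /=; case: eqP => [->|fe]; [left|right].
  case: b; first by exists t; split=> //; [lra|rewrite subrr].
  exists (1 - t); split=> //; first by lra.
  have -> : - t - (1 - t) = -1 :> R by ring.
  by rewrite rpredN rpred1.
split=> // t' t01 /edge_pt_inj[]//; first by case: b; lra.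
by move=> ef; case: fe.
Qed.

(** Up to time 1 the rest of the walk idles at its start; afterwards the first dart has stopped and
    only shifts the lift by an integer. *)
Lemma collapse_walk e u s v t :
  walk G u s v -> collapse_pt e (walk_pt u s t) (walk_lift e s t).
Proof.
elim: s u t => [|d s IH] u t /=; first by move=> _; exact: collapse_vertex.
move=> /andP[_ ws]; have [t1|t1] := leP t 1.
  rewrite (walk_pt_le0 ws) ?subrr ?addr0 ?walk_lift_le0 ?addr0; [|lra..].
  exact: collapse_dart.
rewrite (dart_pt_ge1 _ (ltW t1)) [X in collapse_pt _ X _]addrC subrK.
apply: collapse_pt_shift (IH _ _ ws).
rewrite /dart_lift clamp_ge1; last exact: ltW.
by case: ifP => //; case: d.2; rewrite ?rpredN ?rpred1.
Qed.

Definition skeleton_pt (x : R * R * R * R) : Prop :=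
  (exists v, x = vertex_pt v) \/ (exists e t, 0 < t < 1 /\ x = edge_pt e t).

Lemma skeleton_walk u s v t : walk G u s v -> skeleton_pt (walk_pt u s t).
Proof.
elim: s u t => [|d s IH] u t /=; first by move=> _; left; exists u.
move=> /andP[_ ws]; have [t1|t1] := leP t 1; last first.
  rewrite (dart_pt_ge1 _ (ltW t1)) addrC subrK.
  exact: IH ws.
rewrite (walk_pt_le0 ws) ?subrr ?addr0; last by lra.
have [t0|t0] := leP t 0; first by left; rewrite dart_pt_le0//; eexists.
have [->|t1'] := eqVneq t 1; first by left; rewrite dart_pt_ge1//; eexists.
right; rewrite /dart_pt clamp_id; last by lra.
exists d.1, (if d.2 then t else 1 - t); split=> //.
by case: d.2; move: t1 t1'; rewrite le_eqVlt => /predU1P[->|]; rewrite ?eqxx//; lra.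
Qed.

End Skeleton.

(** * Realization by a CW-complex *)

Lemma hausdorff_injective (X Y : topologicalType) (f : X -> Y) :
  injective f -> continuous f -> hausdorff_space Y -> hausdorff_space X.
Proof.
move=> injf cf hY x y xy; apply/injf/hY => U V Ux Vy.
have [z [Uz Vz]] := xy _ _ (cf _ _ Ux) (cf _ _ Vy).
by exists (f z).
Qed.

Section CWEmbedding.
Local Open Scope classical_set_scope.
Local Open Scope ring_scope.
Context {R : realType} {p q k : nat}.
Variables (G : multigraph p q) (T : topologicalType).
Variables (Phi0 : 'I_p -> T) (Phi1 : 'I_q -> R -> T) (Phi2 : 'I_k -> R * R -> T).
Hypothesis hausT : hausdorff_space T.
Hypothesis Phi1_continuous : forall e, continuous (Phi1 e).
Hypothesis Phi2_continuous : forall f, continuous (Phi2 f).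
Hypothesis Phi1_inj : forall e, {in `]0, 1[ &, injective (Phi1 e)}.
Hypothesis Phi2_inj : forall f, set_inj open_disk (Phi2 f).
Hypothesis Phi_disjoint : forall x c c', open_cell Phi0 Phi1 Phi2 c x ->
  open_cell Phi0 Phi1 Phi2 c' x -> c = c'.
Hypothesis Phi1_tail : forall e, Phi1 e 0 = Phi0 (tail G e).
Hypothesis Phi1_head : forall e, Phi1 e 1 = Phi0 (Defs.head G e).
Hypothesis Phi2_attached : forall f x, unit_circle x ->
  exists c, open_cell Phi0 Phi1 Phi2 (inl c) (Phi2 f x).
Variable v0 : 'I_p.

Let A : set T := [set x | exists c, open_cell Phi0 Phi1 Phi2 c x].

Let A0 v : A (Phi0 v).
Proof. by exists (inl (inl v)). Qed.

Let A1 e t : 0 <= t <= 1 -> A (Phi1 e t).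
Proof.
move=> /andP[]; rewrite le_eqVlt => /predU1P[<- _|t0]; first by rewrite Phi1_tail.
rewrite le_eqVlt => /predU1P[->|t1]; first by rewrite Phi1_head.
by exists (inl (inr e)); exists t => //=; rewrite in_itv /= t0.
Qed.

Let A2 f x : closed_disk x -> A (Phi2 f x).
Proof.
rewrite /closed_disk /= le_eqVlt => /predU1P[x1|x1].
  by have [c] := Phi2_attached f x1; exists (inl c).
by exists (inr f); exists x.
Qed.

(** Characteristic maps are total functions; where their value falls outside [A], which never
    happens on a closed cell, the vertex [v0] is a default. *)
Let mk (y : T) : set_type A :=
  if pselect (A y) is left h then exist _ y (mem_set h)
  else exist _ (Phi0 v0) (mem_set (A0 v0)).

Let svI : injective (set_val : A -> T).
Proof. by rewrite set_valE; exact: val_inj. Qed.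

Let mkK y : A y -> set_val (mk y) = y.
Proof. by rewrite /mk; case: pselect. Qed.

Let mk_eq y x : A y -> mk y = x <-> y = set_val x.
Proof.
move=> Ay; split=> [<-|yx]; first by rewrite mkK.
by apply: svI; rewrite [LHS]mkK.
Qed.

Let mk_inj y y' : A y -> A y' -> mk y = mk y' -> y = y'.
Proof. by move=> Ay Ay' /(congr1 (set_val : A -> T)); rewrite !mkK. Qed.

(** The topology of [A] is initial for the inclusion, whose composite with [mk \o f] is [f] on
    [D]. *)
Let mk_continuous (U : topologicalType) (D : set U) (f : U -> T) :
  continuous f -> (forall x, D x -> A (f x)) -> {within D, continuous (mk \o f)}.
Proof.
move=> cf fA; apply: (@continuous_comp_initial _ _ _ (set_val : A -> T)).
apply: (@subspace_eq_continuous _ _ _ (f : subspace D -> T)).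
  by move=> x /set_mem Dx; rewrite /= mkK//; exact: fA.
exact: continuous_subspaceT.
Qed.

Let disk_sub (x : R * R) : open_disk x -> closed_disk x.
Proof. by move=> /ltW. Qed.

Let open_cellE c x :
  open_cell (mk \o Phi0) (fun e => mk \o Phi1 e) (fun f => mk \o Phi2 f) c x <->
  open_cell Phi0 Phi1 Phi2 c (set_val x).
Proof.
case: c => [[v|e]|f] /=.
- split=> [->|xv]; first by rewrite mkK.
  by apply/esym/mk_eq.
- split=> [[t t01 <-]|[t t01 tx]].
    by exists t => //; rewrite mkK//; apply: A1; move: t01; rewrite /= in_itv/=; lra.
  exists t => //; apply/mk_eq => //; apply: A1; move: t01; rewrite /= in_itv/=; lra.
- split=> [[t td <-]|[t td tx]].
    by exists t => //; rewrite mkK//; apply: A2; exact: disk_sub.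
  by exists t => //; apply/mk_eq => //; apply: A2; exact: disk_sub.
Qed.

(** The complex is the union of the cells, as a subspace of [T]. The inclusion [i] is returned so
    that incidence numbers can be computed with the original maps. *)
Lemma cw_of_embedding : exists (X : cw_complex R G k) (i : X -> T),
  [/\ injective i, forall e t, 0 <= t <= 1 -> i (cell1 X e t) = Phi1 e t &
      forall f x, closed_disk x -> i (cell2 X f x) = Phi2 f x].
Proof.
unshelve eexists.
  apply: (@CWComplex R p q G k (set_type A) (mk \o Phi0)
    (fun e => mk \o Phi1 e) (fun f => mk \o Phi2 f)).
  - apply: (@hausdorff_injective _ _ (set_val : A -> T) svI) => //.
    exact: initial_continuous.
  - move=> e; apply: mk_continuous => // t; rewrite /= in_itv /=; exact: A1.
  - by move=> f; apply: mk_continuous => // x; exact: A2.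
  - move=> e s t s01 t01 /mk_inj st; apply: (@Phi1_inj e s t s01 t01).
    by apply: st; apply: A1; move: s01 t01; rewrite !in_itv /=; lra.
  - move=> f x y xd yd /mk_inj xy; apply: (@Phi2_inj f x y xd yd).
    by apply: xy; apply: A2; apply: disk_sub; exact: set_mem.
  - move=> x; have /set_mem[c cx] := valP x; exists c; split; first exact/open_cellE.
    by move=> c' /open_cellE; exact: Phi_disjoint.
  - by move=> e /=; rewrite Phi1_tail.
  - by move=> e /=; rewrite Phi1_head.
  - move=> f x x1; have [c cx] := Phi2_attached f x1; exists c; apply/open_cellE.
    by rewrite /= mkK//; apply: A2; rewrite /closed_disk /= x1.
exists (set_val : A -> T); split=> [|e t t01|f x xd] /=; first exact: svI.
  by rewrite mkK//; exact: A1.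
by rewrite mkK//; exact: A2.
Qed.

End CWEmbedding.

(** * The embedding and its incidence numbers *)

Section CWConstruction.
Local Open Scope classical_set_scope.
Local Open Scope ring_scope.
Context {R : realType} {p q k : nat}.
Variable G : multigraph p q.
Variables (v0 : 'I_p) (w : 'I_k -> seq (dart (q := q))).
Hypothesis w_closed : forall f, walk G v0 (w f) v0.

(** The walk runs while the abscissa falls from 1/2 to -1/2, which is time 0 to its length. *)
Definition circle_time (f : 'I_k) (x : R) : R := (size (w f))%:R * (1 / 2 - x).

(* On the unit circle the cutoff is 1 wherever the path has left v0, since
   -1/2 < x < 1/2 and y > 0 force 2 y > 1. *)
Definition disk_skel (f : 'I_k) (x : R * R) : R * R * R * R :=
  vertex_pt v0 +
  clamp (2 * x.2) *: (walk_pt G v0 (w f) (circle_time f x.1) - vertex_pt v0).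

Definition disk_cone (f : 'I_k) (x : R * R) : R * R * R * R :=
  let u := 1 - (x.1 ^+ 2 + x.2 ^+ 2) in (u, u * x.1, u * x.2, u * (f : nat)%:R).

Definition emb0 (v : 'I_p) : (R * R * R * R) * (R * R * R * R) :=
  (vertex_pt v, (0, 0, 0, 0)).

Definition emb1 (e : 'I_q) (t : R) : (R * R * R * R) * (R * R * R * R) :=
  (edge_pt G e t, (0, 0, 0, 0)).

Definition emb2 (f : 'I_k) (x : R * R) : (R * R * R * R) * (R * R * R * R) :=
  (disk_skel f x, disk_cone f x).

Lemma circle_time_le0 f x : 1 / 2 <= x -> circle_time f x <= 0.
Proof. by move=> x12; rewrite mulr_ge0_le0 ?ler0n//; lra. Qed.

Lemma circle_time_ge f x : x <= - (1 / 2) -> (size (w f))%:R <= circle_time f x.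
Proof. by move=> x12; rewrite ler_peMr ?ler0n//; lra. Qed.

Lemma disk_skel_lower f x : x.2 <= 0 -> disk_skel f x = vertex_pt v0.
Proof. by move=> x0; rewrite /disk_skel clamp_le0 ?scale0r ?addr0//; lra. Qed.

Lemma disk_skel_upper f x : unit_circle x -> 0 < x.2 ->
  disk_skel f x = walk_pt G v0 (w f) (circle_time f x.1).
Proof.
case: x => x y; rewrite /unit_circle /disk_skel /= => xy y0.
have [x1|x1] := leP (1 / 2) x.
  by rewrite (walk_pt_le0 (w_closed f)) ?circle_time_le0// subrr scaler0 addr0.
have [x2|x2] := leP x (- (1 / 2)).
  by rewrite (walk_pt_ge (w_closed f)) ?circle_time_ge// subrr scaler0 addr0.
have y1 : 1 <= 2 * y by nra.
by rewrite (clamp_ge1 y1) scale1r addrC subrK.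
Qed.

Lemma disk_cone_circle f x : unit_circle x -> disk_cone f x = (0, 0, 0, 0).
Proof. by rewrite /unit_circle /disk_cone /= => ->; rewrite subrr !mul0r. Qed.

Lemma disk_cone_neq0 f x : open_disk x -> disk_cone f x <> (0, 0, 0, 0).
Proof. by rewrite /open_disk /= => x1 []; lra. Qed.

Lemma disk_cone_inj f g x y : open_disk x -> open_disk y ->
  disk_cone f x = disk_cone g y -> f = g /\ x = y.
Proof.
case: x y => [x1 x2] [y1 y2]; rewrite /open_disk /= => xd yd [eu].
rewrite -eu; set u := 1 - _; have u0 : u != 0 by rewrite /u; lra.
move=> /(mulfI u0) -> /(mulfI u0) -> /(mulfI u0)/eqP.
by rewrite eqr_nat => /eqP/val_inj.
Qed.

Lemma disk_cone_continuous f : continuous (disk_cone f).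
Proof.
have cu : continuous (fun x : R * R => 1 - (x.1 ^+ 2 + x.2 ^+ 2)).
  move=> x; apply: cvgB; first exact: cvg_cst.
  by apply: cvgD; apply: cvgM; (exact: cvg_fst || exact: cvg_snd).
apply: continuous_pair; first apply: continuous_pair; first apply: continuous_pair => //.
- by move=> x; apply: cvgM; [exact: cu|exact: cvg_fst].
- by move=> x; apply: cvgM; [exact: cu|exact: cvg_snd].
- by move=> x; apply: cvgM; [exact: cu|exact: cvg_cst].
Qed.

Lemma disk_skel_continuous f : continuous (disk_skel f).
Proof.
have c1 : continuous (fun x : R * R => walk_pt G v0 (w f) (circle_time f x.1)).
  have ct : continuous (fun x : R * R => circle_time f x.1).
    move=> x; apply: cvgM; first exact: cvg_cst.
    by apply: cvgB; [exact: cvg_cst|exact: cvg_fst].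
  by move=> x; exact: (continuous_comp (ct x) (@walk_pt_continuous _ _ _ G _ _ _)).
have c2 : continuous (fun x : R * R => clamp (2 * x.2)).
  have ct : continuous (fun x : R * R => 2 * x.2).
    by move=> x; apply: cvgM; [exact: cvg_cst|exact: cvg_snd].
  by move=> x; exact: (continuous_comp (ct x) (@clamp_continuous _ _)).
move=> x; apply: cvgD; first exact: cvg_cst.
by apply: cvgZ; [exact: c2|apply: cvgB; [exact: c1|exact: cvg_cst]].
Qed.

(** The first four coordinates separate the cells of the graph. The other four vanish there, are
    nonzero on the open disks and determine the disk. *)
Lemma emb_disjoint x c c' : open_cell emb0 emb1 emb2 c x ->
  open_cell emb0 emb1 emb2 c' x -> c = c'.
Proof.
case: c c' => [[v|e]|f] [[v'|e']|f'] /=.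
- by move=> -> /(congr1 fst)/vertex_pt_inj ->.
- move=> -> [t]; rewrite /= in_itv /= => t01 /(congr1 fst)/edge_pt_neq_vertex.
  by case.
- by move=> -> [y yd /(congr1 snd)/disk_cone_neq0]; case.
- move=> [t + <-] /(congr1 fst); rewrite /= in_itv /= => t01 /edge_pt_neq_vertex.
  by case.
- move=> [t + <-] [s + /(congr1 fst)]; rewrite /= !in_itv /= => t01 s01.
  by case/edge_pt_inj => // ->.
- by move=> [t _ <-] [y yd /(congr1 snd)/disk_cone_neq0]; case.
- by move=> [y yd <-] /(congr1 snd)/disk_cone_neq0; case.
- by move=> [y yd <-] [t _ /(congr1 snd)/esym/disk_cone_neq0]; case.
- by move=> [y yd <-] [z zd /(congr1 snd)/disk_cone_inj] [] // ->.
Qed.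

Lemma emb_attached f x : unit_circle x ->
  exists c, open_cell emb0 emb1 emb2 (inl c) (emb2 f x).
Proof.
move=> x1; have : skeleton_pt G (disk_skel f x).
  have [x0|x0] := leP x.2 0; first by left; exists v0; rewrite disk_skel_lower.
  by rewrite disk_skel_upper//; apply: skeleton_walk (w_closed f).
rewrite /emb2 disk_cone_circle//; case=> [[v ->]|[e [t [t01 ->]]]].
  by exists (inl v).
by exists (inr e), t => //=; rewrite in_itv.
Qed.

Lemma emb_cw : exists (X : cw_complex R G k) (i : X -> (R * R * R * R) * (R * R * R * R)),
  [/\ injective i, forall e t, 0 <= t <= 1 -> i (cell1 X e t) = emb1 e t &
      forall f x, closed_disk x -> i (cell2 X f x) = emb2 f x].
Proof.
apply: (cw_of_embedding (Phi0 := emb0)) => //.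
- move=> e; apply: continuous_pair; first exact: edge_pt_continuous.
  by move=> t; exact: cvg_cst.
- move=> f; apply: continuous_pair; first exact: disk_skel_continuous.
  exact: disk_cone_continuous.
- move=> e s t; rewrite !in_itv /= => s01 t01 /(congr1 fst).
  by case/(@edge_pt_inj _ _ _ G e e) => //.
- by move=> f x y /set_mem xd /set_mem yd /(congr1 snd)/disk_cone_inj[].
- exact: emb_disjoint.
- by move=> e; rewrite /emb1 edge_pt0.
- by move=> e; rewrite /emb1 edge_pt1.
- exact: emb_attached.
Qed.

(* The parameter is frozen on the lower half circle, where the attaching map
   is constant. *)
Definition circle_lift (e : 'I_q) (f : 'I_k) (s : R) : R :=
  walk_lift e (w f) (circle_time f (cos (pi * clamp (2 * s)))).

Lemma circle_lift_continuous e f : continuous (circle_lift e f).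
Proof.
have c1 : continuous (fun s : R => clamp (2 * s)).
  have ct : continuous (fun s : R => 2 * s).
    by move=> s; apply: cvgM; [exact: cvg_cst|exact: cvg_id].
  by move=> s; exact: (continuous_comp (ct s) (@clamp_continuous _ _)).
have c2 : continuous (fun s : R => pi * clamp (2 * s)).
  by move=> s; apply: cvgM; [exact: cvg_cst|exact: c1].
have c3 : continuous (fun s : R => cos (pi * clamp (2 * s))).
  by move=> s; exact: (continuous_comp (c2 s) (@continuous_cos _ _)).
have c4 : continuous (fun s : R => circle_time f (cos (pi * clamp (2 * s)))).
  move=> s; apply: cvgM; first exact: cvg_cst.
  by apply: cvgB; [exact: cvg_cst|exact: c3].
by move=> s; exact: (continuous_comp (c4 s) (@walk_lift_continuous _ _ _ _ _)).
Qed.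

Lemma circle_lift_start e f s : s <= 0 -> circle_lift e f s = 0.
Proof.
move=> s0; rewrite /circle_lift clamp_le0 ?mulr0 ?cos0; last by lra.
by rewrite walk_lift_le0// circle_time_le0//; lra.
Qed.

Lemma circle_lift_end e f s : 1 / 2 <= s ->
  circle_lift e f s = (walk_vector (w f) e 0)%:~R.
Proof.
move=> s0; rewrite /circle_lift clamp_ge1 ?mulr1 ?cospi; last by lra.
by rewrite walk_lift_ge// circle_time_ge//; lra.
Qed.

Lemma circle_param_unit (s : R) : unit_circle (circle_param s).
Proof. by rewrite /unit_circle /circle_param /= cos2Dsin2. Qed.

(** On the lower half circle the point is at [v0] and the lift is frozen at an integer; on the open
    upper half both follow the walk. *)
Lemma collapse_circle e f s : 0 <= s <= 1 ->
  collapse_pt G e (disk_skel f (circle_param s)) (circle_lift e f s).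
Proof.
move=> s01; have pi0 := pi_gt0 R.
have [s12|s12] := leP s (1 / 2); last first.
  rewrite disk_skel_lower /=; last first.
    have -> : pi *+ 2 * s = pi * (2 * s - 1) + pi by rewrite mulr2n; ring.
    by rewrite sinDpi oppr_le0; apply: sin_ge0_pi; apply/andP; split; nra.
  by apply: collapse_vertex; rewrite circle_lift_end ?intr_int// ltW.
have cs : circle_lift e f s = walk_lift e (w f) (circle_time f (circle_param s).1).
  rewrite /circle_lift /circle_param /= clamp_id; last by lra.
  by congr (walk_lift _ _ (circle_time _ (cos _))); rewrite mulr2n; ring.
have [y0|y0] := leP (circle_param s).2 0; last first.
  by rewrite (disk_skel_upper _ (circle_param_unit s) y0) cs; apply: collapse_walk (w_closed f).
(* Only the points (1, 0) and (-1, 0) remain, where the walk has not started or has ended. *)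
rewrite disk_skel_lower//; apply: collapse_vertex; rewrite cs.
have y00 : (circle_param s).2 = 0.
  apply/eqP; rewrite eq_le y0 /= sin_ge0_pi//.
  by rewrite mulr2n; apply/andP; split; nra.
have : (circle_param s).1 ^+ 2 = 1.
  by rewrite -(circle_param_unit s) y00 expr0n addr0.
move=> /eqP; rewrite sqrf_eq1 => /orP[] /eqP ->.
  by rewrite walk_lift_le0 ?circle_time_le0 ?rpred0//; lra.
by rewrite walk_lift_ge ?circle_time_ge ?intr_int//; lra.
Qed.

Lemma exists_cw_walks : exists X : cw_complex R G k,
  cellular_boundary X (\matrix_(e, f) walk_vector (w f) e 0).
Proof.
have [X [i [injX i1 i2]]] := emb_cw; exists X => e f; exists (circle_lift e f).
split; first exact/continuous_subspaceT/circle_lift_continuous; last first.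
  by rewrite (circle_lift_start e f (lexx 0)) circle_lift_end ?subr0 ?mxE//; lra.
move=> s; rewrite in_itv /= => s01.
have x1 := circle_param_unit s.
have i2s : i (cell2 X f (circle_param s)) = emb2 f (circle_param s).
  by apply: i2; rewrite /closed_disk /= x1.
have [[t [t01 et yt]]|[ne yint]] := collapse_circle e f s01.
  left; exists t; first by rewrite in_itv.
  split=> //; apply: injX; rewrite i2s i1; last by lra.
  by rewrite /emb1 /emb2 et disk_cone_circle.
right; split=> // -[t]; rewrite /= in_itv /= => t01 tx.
have := i1 e t; rewrite tx i2s => i1t.
by apply: (ne t t01); apply/esym/(congr1 fst (i1t _)); lra.
Qed.

End CWConstruction.

Lemma exists_cw_complex (R : realType) p q k (G : multigraph p q) (D : 'M[int]_(q, k)) :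
  connected_graph G -> incidence G *m D = 0 ->
  exists X : cw_complex R G k, cellular_boundary X D.
Proof.
move=> cG GD; pose v0 : 'I_p := Ordinal cG.1.
have exw f : exists s, walk G v0 s v0 /\ walk_vector s = col f D.
  have [|s ws sD] := exists_closed_walk R cG v0 (z := col f D); last by exists s.
  by rewrite colE mulmxA GD mul0mx.
have [w wP] := boolp.choice exw.
have [X bX] := exists_cw_walks (R := R) (fun f => (wP f).1).
exists X; suff <- : \matrix_(e, f) walk_vector (w f) e 0 = D by [].
by apply/matrixP => e f; rewrite mxE (wP f).2 mxE.
Qed.

(** For [lambda = 0] the space V would be all of ker d_1, of dimension m, whence the case
    [lambda != 0]. As [d] precedes [zY], one constant serves all choices of orientations. *)
Theorem mainTheorem3 (R : realType) (p q l n : nat) (G : multigraph p q)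
    (bd : 'M[int]_(q, l)) (lambda : 'cV[R]_q)
    (hG : connected_graph G)
    (hbd : incidence G *m bd = 0)
    (hn : \rank (@toR R q l bd) = n)
    (hlambda : harmonic_cycle G bd lambda) :
  (forall j : 'I_l, inner lambda (col j (toR bd)) = 0) /\
  (lambda != 0 ->
   let V := orthV G lambda in
   let m := \dim (@ker_incidence R p q G) in
   let r := \dim V in
   let good_basis (bd' : 'M[R]_(q, r)) :=
     basis_of V (columns bd') /\ includes_columns n (toR bd) bd' in
   [/\ r.+1 = m,
       exists bd' : 'M[R]_(q, r), good_basis bd',
       forall bd' : 'M[R]_(q, r), good_basis bd' ->
       forall beta : 'M[int]_(q, r.+1), Z1_basis G beta ->
       exists d : R, forall zY : {set 'I_q} -> 'cV[int]_q,
         (forall Y, cycletree G Y -> is_cycle_vector G Y (zY Y)) ->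
         lambda = d *: standard_harmonic_cycle G beta bd' zY &
       (exists lambdaQ : 'cV[rat]_q, lambda = map_mx ratr lambdaQ) ->
         (exists D : 'M[int]_(q, r), good_basis (toR D)) /\
         (forall D : 'M[int]_(q, r), good_basis (toR D) ->
            exists X : cw_complex R G r, cellular_boundary X D)]).
Proof.
split=> [j|l0 V m r good_basis]; first exact: harmonic_cycle_orth hlambda.
have [Gl _] := harmonic_cycleP hlambda.
split.
- exact: dim_orthV.
- by rewrite /good_basis -hn; exact: exists_good_basis.
- by move=> bd' [bV _] beta Zb; exact: harmonic_cycle_standard.
move=> [lambdaQ lQ]; split.
  rewrite /good_basis /r /V -hn; subst lambda.
  exact: exists_integral_good_basis.
move=> D [/basis_orthVP[ND _] _]; apply: exists_cw_complex => //.
(* The upper block of [orth_mx] gives d_1 D = 0 over [R], which descends to the integers. *)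
move: ND; rewrite /orth_mx mul_col_mx => /eqP; rewrite col_mx_eq0 => /andP[/eqP GD _].
apply/matrixP => i j; apply/eqP.
have /matrixP/(_ i j)/eqP := GD.
by rewrite /toR -map_mxM !mxE intr_eq0.
Qed.
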